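(* For every $\Omega\subseteq\Pi$, the logic $\mathsf{QN4}(\Omega)$ is induced by the Nelsonian sheaf semantics $(EP_n(\Omega),\models^+_n)$; that is, for all $\Gamma,\Delta\subseteq\mathcal{FO}(\Omega)$ we have $(\Gamma,\Delta)\in\mathsf{QN4}(\Omega)$ if and only if there is no $(\mathcal S,\mathbf w,f)\in EP_n(\Omega)$ such that $\mathcal S,\mathbf w\models^+_n\phi[f]$ for all $\phi\in\Gamma$ and $\mathcal S,\mathbf w\not\models^+_n\psi[f]$ for all $\psi\in\Delta$.
   Context: **Language.** $Ind=\{v_n\mid n\in\omega\}$ is the set of variables; $\Pi$ consists of unary predicates $p_n$ ($n\in\omega$), unary $S,O$, binary $E$, ternary $R$; $\epsilon$ is a further binary predicate, not in $\Pi$. For $\Omega\subseteq\Pi$, $\mathcal{FO}(\Omega)$ is generated from atoms $x\equiv y$ and $P(x_1,\ldots,x_n)$ ($P\in\Omega$) by $\wedge,\vee,\to,\sim,\forall x,\exists x$. $\phi\leftrightarrow\psi:=(\phi\to\psi)\wedge(\psi\to\phi)$. $\phi[x/y]$ is the result of replacing the free occurrences of $x$ in $\phi$ by $y$. **The logic $\mathsf{QN4}(\Omega)$.** It is given by the axiom schemes (over $\mathcal{FO}(\Omega)$): $\phi\to(\psi\to\phi)$; $(\phi\to(\psi\to\chi))\to((\phi\to\psi)\to(\phi\to\chi))$; $(\phi\wedge\psi)\to\phi$; $(\phi\wedge\psi)\to\psi$; $\phi\to(\psi\to(\phi\wedge\psi))$; $\phi\to(\phi\vee\psi)$; $\psi\to(\phi\vee\psi)$;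 $(\phi\to\chi)\to((\psi\to\chi)\to((\phi\vee\psi)\to\chi))$; $\forall x\phi\to\phi[x/y]$; $\phi[x/y]\to\exists x\phi$; $x\equiv x$; $y\equiv z\to(\phi[x/y]\to\phi[x/z])$ ($y,z$ substitutable for $x$ in $\phi$); $\sim\sim\phi\leftrightarrow\phi$; $\sim(\phi\wedge\psi)\leftrightarrow(\sim\phi\vee\sim\psi)$; $\sim(\phi\vee\psi)\leftrightarrow(\sim\phi\wedge\sim\psi)$; $\sim(\phi\to\psi)\leftrightarrow(\phi\wedge\sim\psi)$; $\sim\exists x\theta\leftrightarrow\forall x\sim\theta$; $\sim\forall x\theta\leftrightarrow\exists x\sim\theta$; and the rules: (MP) from $\phi$ and $\phi\to\psi$ infer $\psi$; from $\psi\to\phi[x/y]$ infer $\psi\to\forall x\phi$; from $\phi[x/y]\to\psi$ infer $\exists x\phi\to\psi$ (in the last two, $y$ is substitutable for $x$ in $\phi$, and $y$ is free neither in $\psi$ nor in $\forall x\phi$). $\phi$ is provable iff it ends a finite sequence of formulas each of which is an axiom or follows from earlier ones by a rule. $(\Gamma,\Delta)\in\mathsf{QN4}(\Omega)$ means: there is a finite sequence of formulas, each in $\Gamma$, or provable, or obtained from earlier ones by (MP), whose last element is $\theta_1\vee\ldots\vee\theta_s$ for some $\theta_1,\ldots,\theta_s\in\Delta$ ($s\geq1$). **Nelsonian sheaves.** A Nelsonian $\Omega$-sheaf is $\mathcal S=(W,\leq,\mathtt M^+,\mathtt M^-,\mathtt H)$ where $W\neq\emptyset$; $\leq$ is a preorder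 on $W$; for each $\mathbf w\in W$, $\mathtt M^+_{\mathbf w}$ is a classical first-order structure for $\Omega$ and $\mathtt M^-_{\mathbf w}$ one for $\Omega\cup\{\epsilon\}$, with a common nonempty domain $U_{\mathbf w}$; for $\mathbf w\leq\mathbf v$, $\mathtt H_{\mathbf w\mathbf v}:U_{\mathbf w}\to U_{\mathbf v}$ is a homomorphism (i.e. $\bar a\in P$ implies $\mathtt H_{\mathbf w\mathbf v}(\bar a)\in P$ for each predicate $P$) both from $\mathtt M^+_{\mathbf w}$ to $\mathtt M^+_{\mathbf v}$ and from $\mathtt M^-_{\mathbf w}$ to $\mathtt M^-_{\mathbf v}$; $\mathtt H_{\mathbf w\mathbf w}$ is the identity; and $\mathtt H_{\mathbf v\mathbf u}(\mathtt H_{\mathbf w\mathbf v}(a))=\mathtt H_{\mathbf w\mathbf u}(a)$ for $\mathbf w\leq\mathbf v\leq\mathbf u$. $EP_n(\Omega)$ is the class of triples $(\mathcal S,\mathbf w,f)$ with $\mathcal S$ a Nelsonian $\Omega$-sheaf, $\mathbf w\in W$, $f:Ind\to U_{\mathbf w}$. Below $f\circ\mathtt H_{\mathbf w\mathbf v}$ is the function $x\mapsto\mathtt H_{\mathbf w\mathbf v}(f(x))$, and $f[x/a]$ is $f$ with its value at $x$ changed to $a$. Satisfaction ($\ast\in\{+,-\}$): - $\mathbf w\models^\ast_nP(\bar x)[f]$ iff $f(\bar x)\in P^{\mathtt M^\ast_{\mathbf w}}$; - $\mathbf w\models^+_n(x\equiv y)[f]$ iff $f(x)=f(y)$; $\mathbf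 w\models^-_n(x\equiv y)[f]$ iff $(f(x),f(y))\in\epsilon^{\mathtt M^-_{\mathbf w}}$; - $\mathbf w\models^+_n(\psi\wedge\chi)[f]$ iff $\mathbf w\models^+_n\psi[f]$ and $\mathbf w\models^+_n\chi[f]$; $\mathbf w\models^-_n(\psi\wedge\chi)[f]$ iff $\mathbf w\models^-_n\psi[f]$ or $\mathbf w\models^-_n\chi[f]$; - $\mathbf w\models^+_n(\psi\vee\chi)[f]$ iff $\mathbf w\models^+_n\psi[f]$ or $\mathbf w\models^+_n\chi[f]$; $\mathbf w\models^-_n(\psi\vee\chi)[f]$ iff $\mathbf w\models^-_n\psi[f]$ and $\mathbf w\models^-_n\chi[f]$; - $\mathbf w\models^+_n(\psi\to\chi)[f]$ iff for all $\mathbf v\geq\mathbf w$, $\mathbf v\not\models^+_n\psi[f\circ\mathtt H_{\mathbf w\mathbf v}]$ or $\mathbf v\models^+_n\chi[f\circ\mathtt H_{\mathbf w\mathbf v}]$; $\mathbf w\models^-_n(\psi\to\chi)[f]$ iff $\mathbf w\models^+_n\psi[f]$ and $\mathbf w\models^-_n\chi[f]$; - $\mathbf w\models^+_n\sim\psi[f]$ iff $\mathbf w\models^-_n\psi[f]$; $\mathbf w\models^-_n\sim\psi[f]$ iff $\mathbf w\models^+_n\psi[f]$; - $\mathbf w\models^+_n(\exists x\psi)[f]$ iff for some $a\in U_{\mathbf w}$, $\mathbf w\models^+_n\psi[f[x/a]]$; $\mathbf w\models^-_n(\exists x\psi)[f]$ iff for all $\mathbf v\geq\mathbf w$ and $a\in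 U_{\mathbf v}$, $\mathbf v\models^-_n\psi[(f\circ\mathtt H_{\mathbf w\mathbf v})[x/a]]$; - $\mathbf w\models^+_n(\forall x\psi)[f]$ iff for all $\mathbf v\geq\mathbf w$ and $a\in U_{\mathbf v}$, $\mathbf v\models^+_n\psi[(f\circ\mathtt H_{\mathbf w\mathbf v})[x/a]]$; $\mathbf w\models^-_n(\forall x\psi)[f]$ iff for some $a\in U_{\mathbf w}$, $\mathbf w\models^-_n\psi[f[x/a]]$.
   Formalization: In the axiom schemes ∀xφ→φ[x/y] and φ[x/y]→∃xφ, y is required to be substitutable for x in φ, as in the equality scheme; without this the calculus would prove the invalid formula ∀x∃y∼(x≡y)→∃y∼(y≡y). *)

(* Defs.v *)
From Stdlib Require List.
From mathcomp Require Import all_boot.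

Set Implicit Arguments.
Unset Strict Implicit.
Unset Printing Implicit Defensive.

Definition Ind : Type := nat.

Inductive Pi : Type := p_ of nat | S_ | O_ | E_ | R_.

Definition Pi_arity (P : Pi) : nat :=
  match P with p_ _ | S_ | O_ => 1 | E_ => 2 | R_ => 3 end.

Record signature : Type := Signature { sym :> Type; arity : sym -> nat }.

Definition sub_sig (Omega : Pi -> Prop) : signature :=
  @Signature {P : Pi | Omega P} (fun P => Pi_arity (sval P)).

(* [None] is the symbol epsilon; it is available in structures, but it is never
   added to the language of the formulas. *)
Definition with_eps (L : signature) : signature :=
  @Signature (option L) (oapp (@arity L) 2).

Inductive form (L : signature) : Type :=
| Eq of Ind & Ind
| Rel (P : L) of (arity P).-tuple Ind
| And of form L & form L
| Or of form L & form L
| Imp of form L & form L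
| Neg of form L
| All of Ind & form L
| Ex of Ind & form L.

Arguments Eq {L}.
Arguments Rel {L}.

Definition FO (Omega : Pi -> Prop) : Type := form (sub_sig Omega).

Section Syntax.
Variable L : signature.
Implicit Types (phi psi chi : form L) (x y z : Ind).

Definition Iff phi psi : form L := And (Imp phi psi) (Imp psi phi).

Fixpoint free x phi : bool :=
  match phi with
  | Eq y z => (x == y) || (x == z)
  | Rel P ys => x \in ys
  | And psi chi | Or psi chi | Imp psi chi => free x psi || free x chi
  | Neg psi => free x psi
  | All z psi | Ex z psi => (x != z) && free x psi
  end.

Definition rename x y z : Ind := if z == x then y else z.

(* phi[x/y]: bound variables are not renamed, so y may be captured; see
   [substitutable]. *)
Fixpoint subst x y phi : form L :=
  match phi with
  | Eq u v => Eq (rename x y u) (rename x y v)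
  | Rel P us => Rel P (map_tuple (rename x y) us)
  | And psi chi => And (subst x y psi) (subst x y chi)
  | Or psi chi => Or (subst x y psi) (subst x y chi)
  | Imp psi chi => Imp (subst x y psi) (subst x y chi)
  | Neg psi => Neg (subst x y psi)
  | All z psi => if z == x then phi else All z (subst x y psi)
  | Ex z psi => if z == x then phi else Ex z (subst x y psi)
  end.

(* No free occurrence of x in phi lies in the scope of a quantifier on y. *)
Fixpoint substitutable y x phi : bool :=
  match phi with
  | Eq _ _ | Rel _ _ => true
  | And psi chi | Or psi chi | Imp psi chi =>
      substitutable y x psi && substitutable y x chi
  | Neg psi => substitutable y x psi
  | All z psi | Ex z psi =>
      ~~ ((x != z) && free x psi) || (z != y) && substitutable y x psi
  end.

Inductive axiom : form L -> Prop :=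
| ax_K phi psi : axiom (Imp phi (Imp psi phi))
| ax_S phi psi chi :
    axiom (Imp (Imp phi (Imp psi chi)) (Imp (Imp phi psi) (Imp phi chi)))
| ax_andl phi psi : axiom (Imp (And phi psi) phi)
| ax_andr phi psi : axiom (Imp (And phi psi) psi)
| ax_and phi psi : axiom (Imp phi (Imp psi (And phi psi)))
| ax_orl phi psi : axiom (Imp phi (Or phi psi))
| ax_orr phi psi : axiom (Imp psi (Or phi psi))
| ax_or phi psi chi :
    axiom (Imp (Imp phi chi) (Imp (Imp psi chi) (Imp (Or phi psi) chi)))
| ax_all x y phi : substitutable y x phi ->
    axiom (Imp (All x phi) (subst x y phi))
| ax_ex x y phi : substitutable y x phi ->
    axiom (Imp (subst x y phi) (Ex x phi))
| ax_refl x : axiom (Eq x x)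
| ax_eq x y z phi : substitutable y x phi -> substitutable z x phi ->
    axiom (Imp (Eq y z) (Imp (subst x y phi) (subst x z phi)))
| ax_negneg phi : axiom (Iff (Neg (Neg phi)) phi)
| ax_negand phi psi : axiom (Iff (Neg (And phi psi)) (Or (Neg phi) (Neg psi)))
| ax_negor phi psi : axiom (Iff (Neg (Or phi psi)) (And (Neg phi) (Neg psi)))
| ax_negimp phi psi : axiom (Iff (Neg (Imp phi psi)) (And phi (Neg psi)))
| ax_negex x phi : axiom (Iff (Neg (Ex x phi)) (All x (Neg phi)))
| ax_negall x phi : axiom (Iff (Neg (All x phi)) (Ex x (Neg phi))).

Inductive provable : form L -> Prop :=
| prov_ax phi : axiom phi -> provable phi
| prov_MP phi psi : provable phi -> provable (Imp phi psi) -> provable psi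
| prov_all x y phi psi :
    substitutable y x phi -> ~~ free y psi -> ~~ free y (All x phi) ->
    provable (Imp psi (subst x y phi)) -> provable (Imp psi (All x phi))
| prov_ex x y phi psi :
    substitutable y x phi -> ~~ free y psi -> ~~ free y (All x phi) ->
    provable (Imp (subst x y phi) psi) -> provable (Imp (Ex x phi) psi).

(* The quantifier rules apply to theorems only, not to premises in Gamma. *)
Inductive derivable (Gamma : form L -> Prop) : form L -> Prop :=
| der_hyp phi : Gamma phi -> derivable Gamma phi
| der_prov phi : provable phi -> derivable Gamma phi
| der_MP phi psi :
    derivable Gamma phi -> derivable Gamma (Imp phi psi) -> derivable Gamma psi.

End Syntax.

Definition QN4 (Omega : Pi -> Prop) (Gamma Delta : FO Omega -> Prop) : Prop :=
  exists (theta : FO Omega) (thetas : seq (FO Omega)),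
    List.Forall Delta (theta :: thetas) /\
    derivable Gamma (foldl (@Or _) theta thetas).

Definition structure (L : signature) (U : Type) : Type :=
  forall P : L, (arity P).-tuple U -> Prop.

Definition homomorphism (L : signature) (U V : Type)
    (A : structure L U) (B : structure L V) (h : U -> V) : Prop :=
  forall (P : L) (a : (arity P).-tuple U), A P a -> B P (map_tuple h a).

(* [H] takes a proof of w <= v; [H_comp], being stated for all proofs, makes it
   independent of that proof. *)
Record sheaf (Omega : Pi -> Prop) : Type := Sheaf {
  W : Type;
  W_nonempty : inhabited W;
  preceq : W -> W -> Prop;
  preceq_refl : forall w, preceq w w;
  preceq_trans : forall w v u, preceq w v -> preceq v u -> preceq w u;
  U : W -> Type;
  U_nonempty : forall w, inhabited (U w);
  Mpos : forall w, structure (sub_sig Omega) (U w);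
  Mneg : forall w, structure (with_eps (sub_sig Omega)) (U w);
  H : forall w v, preceq w v -> U w -> U v;
  H_pos : forall w v (wv : preceq w v), homomorphism (@Mpos w) (@Mpos v) (H wv);
  H_neg : forall w v (wv : preceq w v), homomorphism (@Mneg w) (@Mneg v) (H wv);
  H_id : forall w (ww : preceq w w) (a : U w), H ww a = a;
  H_comp : forall w v u (wv : preceq w v) (vu : preceq v u) (wu : preceq w u) (a : U w),
    H vu (H wv a) = H wu a
}.

Inductive sign : Type := pos | neg.

Definition update (T : Type) (f : Ind -> T) (x : Ind) (a : T) : Ind -> T :=
  fun y => if y == x then a else f y.

Section Satisfaction.
Variables (Omega : Pi -> Prop) (S : sheaf Omega).

Definition push (w v : W S) (wv : preceq w v) (f : Ind -> U w) : Ind -> U v :=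
  fun x => H wv (f x).

Fixpoint sat (s : sign) (phi : FO Omega) (w : W S) (f : Ind -> U w) : Prop :=
  match phi, s with
  | Eq x y, pos => f x = f y
  | Eq x y, neg =>
      @Mneg _ S w (None : with_eps (sub_sig Omega)) [tuple f x; f y]
  | Rel P xs, pos => @Mpos _ S w P (map_tuple f xs)
  | Rel P xs, neg =>
      @Mneg _ S w (Some P : with_eps (sub_sig Omega)) (map_tuple f xs)
  | And psi chi, pos => sat pos psi f /\ sat pos chi f
  | And psi chi, neg => sat neg psi f \/ sat neg chi f
  | Or psi chi, pos => sat pos psi f \/ sat pos chi f
  | Or psi chi, neg => sat neg psi f /\ sat neg chi f
  | Imp psi chi, pos => forall v (wv : preceq w v),
      ~ sat pos psi (push wv f) \/ sat pos chi (push wv f)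
  | Imp psi chi, neg => sat pos psi f /\ sat neg chi f
  | Neg psi, pos => sat neg psi f
  | Neg psi, neg => sat pos psi f
  | Ex x psi, pos => exists a : U w, sat pos psi (update f x a)
  | Ex x psi, neg => forall v (wv : preceq w v) (a : U v),
      sat neg psi (update (push wv f) x a)
  | All x psi, pos => forall v (wv : preceq w v) (a : U v),
      sat pos psi (update (push wv f) x a)
  | All x psi, neg => exists a : U w, sat neg psi (update f x a)
  end.

End Satisfaction.

(* Main.v *)
Require Import Defs.
From Stdlib Require Import Classical ClassicalEpsilon FunctionalExtensionality.
From Stdlib Require Import PropExtensionality ProofIrrelevance.
From Stdlib Require List.
From mathcomp Require Import all_boot.

(** Soundness is an induction on derivations: satisfaction persists along the
    accessibility relation ([sat_mono]), depends on free variables only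
    ([sat_ext]), and substitution of a variable amounts to a change of the
    assignment ([sat_subst]).

    Completeness is a Henkin construction. The language has no constants, so
    variables have to play their part, and since every variable may be bound in a
    given formula, a quantifier is instantiated by the capture-avoiding
    simultaneous substitution [inst]. Its laws, such as that [inst s (All x A)]
    implies [inst (update s x c) A], hold only up to renaming of bound variables.
    They are obtained from equality instead of syntactic identities: substitutions
    with provably equal values give equivalent formulas ([seqv_inst]), and an
    equation for an otherwise absent variable can be discharged because everything
    equals something ([nd_eq_elim]). Equivalent means here that the formulas and
    also their strong negations are equivalent ([seqv]), since [Neg] does not
    respect provable equivalence in Nelson's logic.

    Variables are divided into infinitely many levels with infinitely many
    variables in each. A world is a set of formulas in the variables below some
    level that is closed under derivability, prime, and contains a witness for each
    of its existential formulas. It may contain every formula, as the logic has no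
    explosion. If premises below a level do not entail some conclusions, the new
    variables of that level provide the witnesses for a world which contains the
    premises and none of the conclusions ([theory_extension]); for this the
    countably many formulas are added one by one as long as no conclusion becomes
    derivable. The same extension, applied to a world and a formula outside it,
    produces the later worlds that refute implications and universal formulas
    ([holds_arrow], [holds_all]).

    In the canonical sheaf the domain of a world consists of representatives of
    the classes of provably equal variables, and the transition to a later world
    sends a representative to the new representative of its class. An atom is
    positively true when the world contains it, negatively true when the world
    contains its negation. The axioms for [Neg] reduce each negative clause of
    satisfaction to a positive one, so that satisfaction in a world is membership
    ([truth]).

    Premises and conclusions may use all variables, which would leave none for
    witnesses. They are therefore first renamed injectively into level 0, and
    a derivation of the renamed sequent is turned back into one of the original
    ([entails_inst]). *)

Set Implicit Arguments.
Unset Strict Implicit.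
Unset Printing Implicit Defensive.

(** * Natural deduction *)

Section NaturalDeduction.
Variable L : signature.
Implicit Types (A B C D : form L) (l : seq (form L)) (G : form L -> Prop).

Lemma derivable_cut G G' A :
  (forall B, G B -> derivable G' B) -> derivable G A -> derivable G' A.
Proof.
move=> sub; elim=> [B /sub//|B|B C _ dB _ dBC]; first exact: der_prov.
exact: der_MP dB dBC.
Qed.

Lemma derivable_weaken G G' A :
  (forall B, G B -> G' B) -> derivable G A -> derivable G' A.
Proof. by move=> sub; apply: derivable_cut => B /sub; apply: der_hyp. Qed.

(** The quantifier rules apply to theorems only, so they cannot violate the
    deduction theorem: a step by one of them does not depend on [A]. *)
Lemma deduction G A B :
  derivable (fun C => A = C \/ G C) B -> derivable G (Imp A B).
Proof.
have K C : derivable G C -> derivable G (Imp A C).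
  by move=> dC; apply: (der_MP dC); apply/der_prov/prov_ax/ax_K.
have I : derivable G (Imp A A).
  apply: (der_MP (phi := Imp A (Imp A A))); first exact/der_prov/prov_ax/ax_K.
  apply: (der_MP (phi := Imp A (Imp (Imp A A) A))).
    exact/der_prov/prov_ax/ax_K.
  exact/der_prov/prov_ax/ax_S.
elim=> [C [<-//|GC]|C pC|C D _ dC _ dCD].
- exact/K/der_hyp.
- exact/K/der_prov.
- apply: (der_MP dC); apply: (der_MP dCD); exact/der_prov/prov_ax/ax_S.
Qed.

Lemma compactness G A : derivable G A ->
  exists l, List.Forall G l /\ derivable (fun B => List.In B l) A.
Proof.
elim=> [B GB|B pB|B C _ [l1 [s1 d1]] _ [l2 [s2 d2]]].
- exists [:: B]; split; first by constructor=> //; constructor.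
  by apply: der_hyp; left.
- by exists [::]; split; [constructor|apply: der_prov].
- exists (l1 ++ l2); split; first by apply/List.Forall_app; split.
  apply: (der_MP (phi := B)).
    by apply: derivable_weaken d1 => D Dl; apply/List.in_app_iff; left.
  by apply: derivable_weaken d2 => D Dl; apply/List.in_app_iff; right.
Qed.

Definition nd l A := derivable (fun B => List.In B l) A.
Local Notation "l ⊢ A" := (nd l A) (at level 70).

Lemma nd_hyp l A : List.In A l -> l ⊢ A. Proof. exact: der_hyp. Qed.

Lemma nd_prov l A : provable A -> l ⊢ A. Proof. exact: der_prov. Qed.

Lemma nd_ax l A : axiom A -> l ⊢ A. Proof. by move=> aA; apply/der_prov/prov_ax. Qed.

Lemma nd_weaken l l' A : List.incl l l' -> l ⊢ A -> l' ⊢ A.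
Proof. by move=> sub; apply: derivable_weaken => B; apply: sub. Qed.

Lemma nd_nil l A : [::] ⊢ A -> l ⊢ A.
Proof. by apply: nd_weaken => B []. Qed.

Lemma nd_provable A : [::] ⊢ A -> provable A.
Proof. by elim=> [B []|//|B C _ pB _ /(prov_MP pB)]. Qed.

Lemma nd_impI l A B : A :: l ⊢ B -> l ⊢ Imp A B.
Proof. exact: deduction. Qed.

Lemma nd_mp l A B : l ⊢ Imp A B -> l ⊢ A -> l ⊢ B.
Proof. by move=> dAB dA; apply: der_MP dA dAB. Qed.

Lemma nd_impE l A B : l ⊢ Imp A B -> A :: l ⊢ B.
Proof.
move=> dAB; apply: (nd_mp (A := A)); last by apply: nd_hyp; left.
by apply: nd_weaken dAB => C; right.
Qed.

Lemma nd_cut l A B : l ⊢ A -> A :: l ⊢ B -> l ⊢ B.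
Proof. by move=> dA /nd_impI dAB; apply: nd_mp dAB dA. Qed.

Lemma nd_imp_trans l A B C : l ⊢ Imp A B -> l ⊢ Imp B C -> l ⊢ Imp A C.
Proof.
move=> /nd_impE dB dBC; apply: nd_impI; apply: nd_mp dB.
by apply: nd_weaken dBC => D; right.
Qed.

Lemma nd_imp_refl l A : l ⊢ Imp A A.
Proof. by apply: nd_impI; apply: nd_hyp; left. Qed.

Lemma nd_andI l A B : l ⊢ A -> l ⊢ B -> l ⊢ And A B.
Proof.
move=> dA dB; apply: nd_mp dB; apply: nd_mp dA; exact/nd_ax/ax_and.
Qed.

Lemma nd_andl l A B : l ⊢ And A B -> l ⊢ A.
Proof. by apply: nd_mp; apply/nd_ax/ax_andl. Qed.

Lemma nd_andr l A B : l ⊢ And A B -> l ⊢ B.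
Proof. by apply: nd_mp; apply/nd_ax/ax_andr. Qed.

Lemma nd_orl l A B : l ⊢ A -> l ⊢ Or A B.
Proof. by apply: nd_mp; apply/nd_ax/ax_orl. Qed.

Lemma nd_orr l A B : l ⊢ B -> l ⊢ Or A B.
Proof. by apply: nd_mp; apply/nd_ax/ax_orr. Qed.

Lemma nd_orE l A B C : l ⊢ Imp A C -> l ⊢ Imp B C -> l ⊢ Imp (Or A B) C.
Proof.
move=> dA dB; apply: nd_mp dB; apply: nd_mp dA; exact/nd_ax/ax_or.
Qed.

Lemma nd_iffl l A B : axiom (Iff A B) -> l ⊢ Imp A B.
Proof. by move=> aAB; apply: nd_andl (nd_ax l aAB). Qed.

Lemma nd_iffr l A B : axiom (Iff A B) -> l ⊢ Imp B A.
Proof. by move=> aAB; apply: nd_andr (nd_ax l aAB). Qed.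

Lemma subst_id x A : subst x x A = A.
Proof.
have r y : rename x x y = y by rewrite /rename; case: eqP.
elim: A => [y z|P ys|A IA B IB|A IA B IB|A IA B IB|A IA|z A IA|z A IA] /=;
  rewrite ?r ?IA ?IB ?if_same //.
by congr Rel; apply: val_inj; rewrite /= (eq_map r) map_id.
Qed.

Lemma substitutable_id x A : substitutable x x A.
Proof.
elim: A => [||A IA B IB|A IA B IB|A IA B IB|A IA|z A IA|z A IA] //=;
  rewrite ?IA ?IB // andbT (eq_sym z); case: eqP => //= _; rewrite orbT //.
Qed.

Lemma nd_allE l x A : l ⊢ All x A -> l ⊢ A.
Proof.
apply: nd_mp; rewrite -{2}(subst_id x A).
exact/nd_ax/ax_all/substitutable_id.
Qed.

Lemma nd_exI l x A : l ⊢ A -> l ⊢ Ex x A.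
Proof.
apply: nd_mp; rewrite -{1}(subst_id x A).
exact/nd_ax/ax_ex/substitutable_id.
Qed.

Definition verum : form L := All 0 (Eq 0 0).

Definition conj_list l : form L := foldr (@And L) verum l.

Lemma nd_conj l : l ⊢ conj_list l.
Proof.
elim: l => [|A l IH] /=; last first.
  apply: nd_andI; first by apply: nd_hyp; left.
  by apply: nd_weaken IH => B; right.
(* The premise of the generalization rule has to be a closed theorem. *)
apply: (nd_mp (A := Imp verum verum)); last exact: nd_imp_refl.
apply: nd_prov; rewrite {3}/verum; apply: (@prov_all _ 0 0) => //=.
rewrite /rename eqxx; apply/nd_provable/nd_impI; exact/nd_ax/ax_refl.
Qed.

(** The quantifier rules act on theorems of the form [Imp psi phi]; gathering the
    premises of a list into one conjunction turns them into rules of natural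
    deduction, with the usual condition on the free variables of the premises. *)
Lemma nd_conj_imp l A : l ⊢ A -> provable (Imp (conj_list l) A).
Proof.
have proj C : List.In C l -> [:: conj_list l] ⊢ C.
  elim: l => [|B l IH] // [<-|/IH dC].
    by apply: nd_andl; apply: nd_hyp; left.
  apply: (nd_cut (A := conj_list l)); first by apply: nd_andr; apply: nd_hyp; left.
  by apply: nd_weaken dC => D [<-|[]]; left.
by move=> dA; apply/nd_provable/nd_impI; apply: derivable_cut dA.
Qed.

Lemma free_conj x l : (forall A, List.In A l -> ~~ free x A) -> ~~ free x (conj_list l).
Proof.
elim: l => [|A l IH] /= h; first by case: (x == 0).
by rewrite negb_or h ?IH //=; [move=> B lB; apply: h; right | left].
Qed.

Definition fresh_in x l := forall A, List.In A l -> ~~ free x A.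

Lemma nd_allI l x A : fresh_in x l -> l ⊢ A -> l ⊢ All x A.
Proof.
move=> xl /nd_conj_imp pA; apply: nd_mp (nd_conj l); apply: nd_prov.
apply: (@prov_all _ x x); rewrite ?substitutable_id ?free_conj //=.
  by rewrite eqxx.
by rewrite subst_id.
Qed.

Lemma nd_exE l x A B : fresh_in x l -> ~~ free x B -> A :: l ⊢ B -> l ⊢ Imp (Ex x A) B.
Proof.
move=> xl xB /nd_impI /nd_conj_imp pAB.
have pB : provable (Imp (Ex x A) (Imp (conj_list l) B)).
  apply: (@prov_ex _ x x); rewrite ?substitutable_id //=.
  - by rewrite negb_or free_conj.
  - by rewrite eqxx.
  rewrite subst_id; apply: nd_provable; do 2 apply: nd_impI.
  apply: (nd_mp (A := A)); last by apply: nd_hyp; right; left.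
  apply: (nd_mp (A := conj_list l)); last by apply: nd_hyp; left.
  exact: nd_prov.
apply: nd_impI; apply: (nd_mp (A := conj_list l)).
  by apply: nd_impE; apply: nd_prov.
by apply: nd_weaken (nd_conj l) => C; right.
Qed.

Lemma nd_exE' l x A B :
  fresh_in x l -> ~~ free x B -> l ⊢ Ex x A -> A :: l ⊢ B -> l ⊢ B.
Proof. by move=> xl xB dA dB; apply: nd_mp (nd_exE xl xB dB) dA. Qed.

(** * Substitution *)

Fixpoint fv A : seq Ind :=
  match A with
  | Eq x y => [:: x; y]
  | Rel P xs => xs
  | And B C | Or B C | Imp B C => fv B ++ fv C
  | Neg B => fv B
  | All x B | Ex x B => filter (predC1 x) (fv B)
  end.

Lemma freeE x A : free x A = (x \in fv A).
Proof.
elim: A => [y z|P ys|A IA B IB|A IA B IB|A IA B IB|A IA|z A IA|z A IA] //=;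
  by rewrite ?mem_cat ?mem_filter ?inE ?IA ?IB.
Qed.

Definition above (s : seq nat) : nat := (foldr maxn 0 s).+1.

Lemma ltn_above s x : x \in s -> x < above s.
Proof.
rewrite /above ltnS; elim: s => [//|y s IH]; rewrite inE /= leq_max.
by case/orP => [/eqP ->|/IH ->]; rewrite ?leqnn ?orbT.
Qed.

Lemma above_notin s : above s \notin s.
Proof. by apply/negP => /ltn_above; rewrite ltnn. Qed.

(** Simultaneous substitution of variables for free variables. Every bound
    variable is renamed to one above the values taken by the free variables, so
    that nothing is captured and the recursion is structural. *)
Fixpoint inst (s : Ind -> Ind) A : form L :=
  match A with
  | Eq x y => Eq (s x) (s y)
  | Rel P xs => Rel P (map_tuple s xs)
  | And B C => And (inst s B) (inst s C)
  | Or B C => Or (inst s B) (inst s C)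
  | Imp B C => Imp (inst s B) (inst s C)
  | Neg B => Neg (inst s B)
  | All x B =>
      let z := above (map s (filter (predC1 x) (fv B))) in
      All z (inst (update s x z) B)
  | Ex x B =>
      let z := above (map s (filter (predC1 x) (fv B))) in
      Ex z (inst (update s x z) B)
  end.

Implicit Types s t : Ind -> Ind.

(** This is where the choice of the bound variable in [inst] matters: as [z] is
    no value of a free variable, nothing else is removed with it. *)
Lemma filter_map_update s x z B : z \notin map s (filter (predC1 x) (fv B)) ->
  filter (predC1 z) (map (update s x z) (fv B)) = map s (filter (predC1 x) (fv B)).
Proof.
elim: (fv B) => [//|y t IH] /=; rewrite {1}/update.
case: (eqVneq y x) => [->|yx] /= zt; first by rewrite eqxx /= IH.
move: zt; rewrite inE negb_or eq_sym => /andP[-> /IH /= ->].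
by rewrite /update (negPf yx).
Qed.

Lemma fv_inst s A : fv (inst s A) = map s (fv A).
Proof.
elim: A s => [y z|P ys|A IA B IB|A IA B IB|A IA B IB|A IA|z A IA|z A IA] s //=;
  by rewrite ?map_cat ?IA ?IB ?filter_map_update ?above_notin.
Qed.

Lemma inst_ext s t A : {in fv A, s =1 t} -> inst s A = inst t A.
Proof.
elim: A s t => [y z|P ys|A IA B IB|A IA B IB|A IA B IB|A IA|z A IA|z A IA] s t /= st.
- by rewrite !st ?inE ?eqxx ?orbT.
- by congr Rel; apply/val_inj/eq_in_map.
- by rewrite (IA s t) ?(IB s t) // => x xA; apply: st; rewrite mem_cat xA ?orbT.
- by rewrite (IA s t) ?(IB s t) // => x xA; apply: st; rewrite mem_cat xA ?orbT.
- by rewrite (IA s t) ?(IB s t) // => x xA; apply: st; rewrite mem_cat xA ?orbT.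
- by rewrite (IA s t).
- have -> : map s (filter (predC1 z) (fv A)) = map t (filter (predC1 z) (fv A)).
    exact/eq_in_map.
  congr All; apply: IA => x xA; rewrite /update; case: eqP => // /eqP xz.
  by apply: st; rewrite mem_filter /= xz.
- have -> : map s (filter (predC1 z) (fv A)) = map t (filter (predC1 z) (fv A)).
    exact/eq_in_map.
  congr Ex; apply: IA => x xA; rewrite /update; case: eqP => // /eqP xz.
  by apply: st; rewrite mem_filter /= xz.
Qed.

Lemma fv_quant_inst s x z B : z \notin map s (filter (predC1 x) (fv B)) ->
  fv (All z (inst (update s x z) B)) = map s (fv (All x B)).
Proof. by move=> zB; rewrite /= fv_inst filter_map_update. Qed.

(** * Strong equivalence and replacement *)

Definition sle l A B := l ⊢ Imp A B /\ l ⊢ Imp (Neg A) (Neg B).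

(** Provable equivalence is not preserved by [Neg] in this logic, so that
    replacement needs equivalence of the negations as well. *)
Definition seqv l A B := sle l A B /\ sle l B A.

Lemma sle_refl l A : sle l A A.
Proof. by split; apply: nd_imp_refl. Qed.

Lemma sle_trans l A B C : sle l A B -> sle l B C -> sle l A C.
Proof.
move=> [pAB nAB] [pBC nBC].
by split; [apply: nd_imp_trans pAB pBC|apply: nd_imp_trans nAB nBC].
Qed.

Lemma seqv_refl l A : seqv l A A.
Proof. by split; apply: sle_refl. Qed.

Lemma seqv_sym l A B : seqv l A B -> seqv l B A.
Proof. by case. Qed.

Lemma seqv_trans l A B C : seqv l A B -> seqv l B C -> seqv l A C.
Proof.
move=> [AB BA] [BC CB].
by split; [apply: sle_trans AB BC|apply: sle_trans CB BA].
Qed.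

Lemma seqv_nil l A B : seqv [::] A B -> seqv l A B.
Proof. by case=> [[? ?] [? ?]]; do 2 split; apply: nd_nil. Qed.

Lemma nd_and_mono l A A' B B' :
  l ⊢ Imp A A' -> l ⊢ Imp B B' -> l ⊢ Imp (And A B) (And A' B').
Proof.
move=> dA dB; apply: nd_impI; have hyp : And A B :: l ⊢ And A B.
  by apply: nd_hyp; left.
have wk C : l ⊢ C -> And A B :: l ⊢ C by apply: nd_weaken => D; right.
apply: nd_andI.
  exact: nd_mp (wk _ dA) (nd_andl hyp).
exact: nd_mp (wk _ dB) (nd_andr hyp).
Qed.

Lemma nd_or_mono l A A' B B' :
  l ⊢ Imp A A' -> l ⊢ Imp B B' -> l ⊢ Imp (Or A B) (Or A' B').
Proof.
move=> dA dB; apply: nd_orE.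
  exact: nd_imp_trans dA (nd_ax _ (ax_orl _ _)).
exact: nd_imp_trans dB (nd_ax _ (ax_orr _ _)).
Qed.

Lemma nd_imp_mono l A A' B B' :
  l ⊢ Imp A' A -> l ⊢ Imp B B' -> l ⊢ Imp (Imp A B) (Imp A' B').
Proof.
move=> dA dB; apply: nd_impI.
have wk C : l ⊢ C -> Imp A B :: l ⊢ C by apply: nd_weaken => D; right.
apply: nd_imp_trans (wk _ dA) (nd_imp_trans _ (wk _ dB)).
by apply: nd_hyp; left.
Qed.

Lemma nd_all_mono l x A B :
  fresh_in x l -> l ⊢ Imp A B -> l ⊢ Imp (All x A) (All x B).
Proof.
move=> xl dAB; apply: nd_impI; apply: nd_allI.
  by move=> C [<-|/xl//] /=; rewrite eqxx.
apply: (nd_mp (A := A)); first by apply: nd_weaken dAB => C; right.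
by apply: (nd_allE (x := x)); apply: nd_hyp; left.
Qed.

Lemma nd_ex_mono l x A B :
  fresh_in x l -> l ⊢ Imp A B -> l ⊢ Imp (Ex x A) (Ex x B).
Proof.
move=> xl dAB; apply: nd_exE => //=; first by rewrite eqxx.
by apply: nd_exI; apply: nd_impE.
Qed.

Lemma sle_neg l A B : sle l A B -> sle l (Neg A) (Neg B).
Proof.
move=> [pAB nAB]; split=> //.
apply: nd_imp_trans (nd_iffl _ (ax_negneg _)) _.
exact: nd_imp_trans pAB (nd_iffr _ (ax_negneg _)).
Qed.

Lemma sle_and l A A' B B' : sle l A A' -> sle l B B' -> sle l (And A B) (And A' B').
Proof.
move=> [pA nA] [pB nB]; split; first exact: nd_and_mono.
apply: nd_imp_trans (nd_iffl _ (ax_negand _ _)) _.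
exact: nd_imp_trans (nd_or_mono nA nB) (nd_iffr _ (ax_negand _ _)).
Qed.

Lemma sle_or l A A' B B' : sle l A A' -> sle l B B' -> sle l (Or A B) (Or A' B').
Proof.
move=> [pA nA] [pB nB]; split; first exact: nd_or_mono.
apply: nd_imp_trans (nd_iffl _ (ax_negor _ _)) _.
exact: nd_imp_trans (nd_and_mono nA nB) (nd_iffr _ (ax_negor _ _)).
Qed.

(** An implication is antitone in its premise, but its negation is monotone in
    it, whence the two-sided hypothesis on [A]. *)
Lemma sle_imp l A A' B B' : seqv l A A' -> sle l B B' -> sle l (Imp A B) (Imp A' B').
Proof.
move=> [[pA _] [pA' _]] [pB nB]; split; first exact: nd_imp_mono.
apply: nd_imp_trans (nd_iffl _ (ax_negimp _ _)) _.
exact: nd_imp_trans (nd_and_mono pA nB) (nd_iffr _ (ax_negimp _ _)).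
Qed.

Lemma sle_all l x y A B : l ⊢ Imp (All x A) (All y B) ->
  l ⊢ Imp (Ex x (Neg A)) (Ex y (Neg B)) -> sle l (All x A) (All y B).
Proof.
move=> dall dex; split=> //.
apply: nd_imp_trans (nd_iffl _ (ax_negall _ _)) _.
exact: nd_imp_trans dex (nd_iffr _ (ax_negall _ _)).
Qed.

Lemma sle_ex l x y A B : l ⊢ Imp (Ex x A) (Ex y B) ->
  l ⊢ Imp (All x (Neg A)) (All y (Neg B)) -> sle l (Ex x A) (Ex y B).
Proof.
move=> dex dall; split=> //.
apply: nd_imp_trans (nd_iffl _ (ax_negex _ _)) _.
exact: nd_imp_trans dall (nd_iffr _ (ax_negex _ _)).
Qed.

Lemma seqv_quant l x A B : fresh_in x l -> seqv l A B ->
  seqv l (All x A) (All x B) /\ seqv l (Ex x A) (Ex x B).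
Proof.
move=> xl [[pAB nAB] [pBA nBA]].
by do 2 split; [apply: sle_all|apply: sle_all|apply: sle_ex|apply: sle_ex];
  (apply: nd_all_mono || apply: nd_ex_mono).
Qed.

Definition atomic A : bool := match A with Eq _ _ | Rel _ _ => true | _ => false end.

Lemma subst_inst_atomic p a s A :
  atomic A -> subst p a (inst s A) = inst (rename p a \o s) A.
Proof.
by case: A => // P xs _ /=; congr Rel; apply: val_inj; rewrite /= -map_comp.
Qed.

(** The equality axiom exchanges two variables substituted for a third; the third
    is a new variable [p] put in the place of [x]. *)
Lemma sle_atomic_update l s x a b A : atomic A -> l ⊢ Eq a b ->
  sle l (inst (update s x a) A) (inst (update s x b) A).
Proof.
move=> atA ab; pose p := above (map s (fv A)).
pose B := inst (update s x p) A.
have sub c : subst p c B = inst (update s x c) A.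
  rewrite subst_inst_atomic //; apply: inst_ext => y yA; rewrite /rename /update /=.
  case: (y == x); first by rewrite eqxx.
  case: eqP => // e; have := above_notin (map s (fv A)).
  by rewrite -/p -e map_f.
have atB c : substitutable c p B by rewrite /B; case: (A) atA.
rewrite -!sub; split; first exact: nd_mp (nd_ax _ (ax_eq _ _)) ab.
exact: nd_mp (nd_ax _ (@ax_eq _ p a b (Neg B) (atB _) (atB _))) ab.
Qed.

(** For atomic formulas no variable is bound, so the equality axiom applies
    directly; the variables are exchanged one at a time. *)
Lemma sle_atomic l s t A : atomic A -> (forall x, x \in fv A -> l ⊢ Eq (s x) (t x)) ->
  sle l (inst s A) (inst t A).
Proof.
move=> atA st; pose r (V : seq Ind) x := if x \in V then t x else s x.
suff step V : {subset V <= fv A} -> sle l (inst s A) (inst (r V) A).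
  have -> : inst t A = inst (r (fv A)) A by apply: inst_ext => x xA; rewrite /r xA.
  exact: step.
elim: V => [|v V IH] sub; first exact: sle_refl.
apply: sle_trans (IH _) _ => [x xV|]; first by apply: sub; rewrite inE xV orbT.
have -> : inst (r V) A = inst (update (r V) v (r V v)) A.
  by apply: inst_ext => x _; rewrite /update; case: eqP => [->|].
have -> : inst (r (v :: V)) A = inst (update (r V) v (t v)) A.
  by apply: inst_ext => x _; rewrite /update /r inE; case: eqP => [->|].
apply: sle_atomic_update => //; rewrite /r; case: ifP => _.
  exact/nd_ax/ax_refl.
by apply: st; apply: sub; rewrite inE eqxx.
Qed.

Lemma nd_eq_refl l x : l ⊢ Eq x x.
Proof. exact/nd_ax/ax_refl. Qed.

Lemma nd_eq_sym l x y : l ⊢ Eq x y -> l ⊢ Eq y x.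
Proof.
move=> xy; pose t n : Ind := if n == 0 then y else x.
have st z : z \in fv (Eq 0 1 : form L) -> l ⊢ Eq x (t z).
  by rewrite /t; case: ifP => // _ _; apply: nd_eq_refl.
by have [d _] := @sle_atomic l (fun=> x) t (Eq 0 1) isT st; apply: nd_mp d (nd_eq_refl _ _).
Qed.

Lemma nd_eq_trans l x y z : l ⊢ Eq x y -> l ⊢ Eq y z -> l ⊢ Eq x z.
Proof.
move=> xy yz; pose s n : Ind := if n == 0 then x else y.
pose t n : Ind := if n == 0 then x else z.
have st u : u \in fv (Eq 0 1 : form L) -> l ⊢ Eq (s u) (t u).
  by rewrite /s /t; case: ifP => // _ _; apply: nd_eq_refl.
by have [d _] := @sle_atomic l s t (Eq 0 1) isT st; apply: nd_mp d xy.
Qed.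

(** Every variable equals something, so a variable that occurs in a single
    premise, an equation, can be discharged with that premise. *)
Lemma nd_eq_elim l x y B :
  fresh_in x l -> ~~ free x B -> Eq x y :: l ⊢ B -> l ⊢ B.
Proof.
move=> xl xB dB; have [xy|xy] := eqVneq x y.
  by apply: nd_cut dB; rewrite xy; apply: nd_eq_refl.
apply: nd_exE' xl xB _ dB.
have := nd_ax l (@ax_ex _ x y (Eq x y) isT); rewrite /= /rename eqxx eq_sym (negPf xy).
by move/nd_mp; apply; apply: nd_eq_refl.
Qed.

Lemma nd_eq_elim_r l x y B :
  fresh_in x l -> ~~ free x B -> Eq y x :: l ⊢ B -> l ⊢ B.
Proof.
move=> xl xB dB; apply: (nd_eq_elim (y := y) xl xB).
apply: (nd_cut (A := Eq y x)); first by apply: nd_eq_sym; apply: nd_hyp; left.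
by apply: nd_weaken dB => C [<-|lC]; [left|right; right].
Qed.

Lemma fresh_cons x A l : ~~ free x A -> fresh_in x l -> fresh_in x (A :: l).
Proof. by move=> xA xl B [<-|/xl]. Qed.

(** Generalizing over [w] needs [B] from [All z A] without the premise
    [Eq z w]; it is discharged as [z] no longer occurs. *)
Lemma nd_all_rebind z w A B : [:: Eq z w] ⊢ Imp A B ->
  ~~ free z (All w B) -> ~~ free w (All z A) -> [::] ⊢ Imp (All z A) (All w B).
Proof.
move=> dAB zB wA; apply: nd_impI.
apply: nd_allI; first by apply: fresh_cons.
have dA : [:: All z A] ⊢ A by apply: (nd_allE (x := z)); apply: nd_hyp; left.
have dB : [:: Eq z w; All z A] ⊢ B.
  apply: (nd_mp (A := A)); first by apply: nd_weaken dAB => C [<-|[]]; left.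
  by apply: nd_weaken dA => C; right.
have [zw|zw] := eqVneq z w.
  by apply: nd_cut dB; rewrite zw; apply: nd_eq_refl.
apply: nd_eq_elim dB; first by apply: fresh_cons => //=; rewrite eqxx.
by move: zB; rewrite /= zw.
Qed.

Lemma nd_ex_rebind z w A B : [:: Eq z w] ⊢ Imp A B ->
  ~~ free z (All w B) -> ~~ free w (All z A) -> [::] ⊢ Imp (Ex z A) (Ex w B).
Proof.
move=> dAB zB wA; apply: nd_exE => //.
have dB : [:: Eq z w; A] ⊢ Ex w B.
  apply: nd_exI; apply: (nd_mp (A := A)); last by apply: nd_hyp; right; left.
  by apply: nd_weaken dAB => C [<-|[]]; left.
have [zw|zw] := eqVneq z w.
  by apply: nd_cut dB; rewrite zw; apply: nd_eq_refl.
apply: nd_eq_elim_r dB; last by rewrite /= eqxx.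
by apply: fresh_cons => //; move: wA; rewrite /= eq_sym zw.
Qed.

(** Renaming of a bound variable, in a form that does not mention substitution:
    that [B] is [A] with [w] for [z] is expressed by their being equivalent
    as soon as [z] equals [w]. *)
Lemma seqv_rebind z w A B : seqv [:: Eq z w] A B ->
  ~~ free z (All w B) -> ~~ free w (All z A) ->
  seqv [::] (All z A) (All w B) /\ seqv [::] (Ex z A) (Ex w B).
Proof.
move=> [[pAB nAB] [pBA nBA]] zB wA.
have flip C D : [:: Eq z w] ⊢ Imp C D -> [:: Eq w z] ⊢ Imp C D.
  move=> dCD; apply: (nd_cut (A := Eq z w)); last first.
    by apply: nd_weaken dCD => E [<-|[]]; left.
  by apply: nd_eq_sym; apply: nd_hyp; left.
split; split; [apply: sle_all|apply: sle_all|apply: sle_ex|apply: sle_ex];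
  (apply: nd_all_rebind || apply: nd_ex_rebind) => //; exact: flip.
Qed.

Lemma fresh_free_quant_inst s x z w B :
  z \notin map s (fv (All x B)) -> w \notin map s (fv (All x B)) ->
  ~~ free w (All z (inst (update s x z) B)).
Proof. by move=> zB wB; rewrite freeE fv_quant_inst. Qed.

Lemma eq_update l s t x z w :
  (forall y, y != x -> l ⊢ Eq (s y) (t y)) -> l ⊢ Eq z w ->
  forall y, l ⊢ Eq (update s x z y) (update t x w y).
Proof. by move=> st zw y; rewrite /update; case: eqP => // /eqP /st. Qed.

Lemma eq_update_hyp s x z w y : [:: Eq z w] ⊢ Eq (update s x z y) (update s x w y).
Proof.
apply: eq_update; first by move=> ? _; apply: nd_eq_refl.
by apply: nd_hyp; left.
Qed.

Definition list_fv l : seq Ind := flatten (map fv l).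

Lemma fresh_in_fv x l : x \notin list_fv l -> fresh_in x l.
Proof.
elim: l => [|A l IH]; first by move=> _ B [].
rewrite /list_fv /= mem_cat negb_or -freeE => /andP[xA /IH]; exact: fresh_cons.
Qed.

Definition replaceable A := forall l s t,
  (forall x, x \in fv A -> l ⊢ Eq (s x) (t x)) -> seqv l (inst s A) (inst t A).

Lemma seqv_inst_quant l s x w A : replaceable A -> w \notin map s (fv (All x A)) ->
  seqv l (inst s (All x A)) (All w (inst (update s x w) A)) /\
  seqv l (inst s (Ex x A)) (Ex w (inst (update s x w) A)).
Proof.
move=> repA wA; have zA := above_notin (map s (fv (All x A))).
set z := above _ in zA.
have zw := repA _ _ _ (fun y _ => eq_update_hyp s x z w y).
have [||? ?] := seqv_rebind zw; last by split; apply: seqv_nil.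
  exact: fresh_free_quant_inst wA zA.
exact: fresh_free_quant_inst zA wA.
Qed.

(** At a quantifier the two bound variables may differ, and either may clash with
    values of the other substitution; both are therefore renamed to a common variable
    [w] that is new altogether, after which the induction hypothesis applies. *)
Lemma seqv_inst A : replaceable A.
Proof.
elim: A => [y z|P ys|A IA B IB|A IA B IB|A IA B IB|A IA|x A IA|x A IA] l s t st.
- have ts u : u \in fv (Eq y z : form L) -> l ⊢ Eq (t u) (s u).
    by move/st; apply: nd_eq_sym.
  by split; apply: sle_atomic.
- have ts u : u \in fv (Rel P ys) -> l ⊢ Eq (t u) (s u) by move/st; apply: nd_eq_sym.
  by split; apply: sle_atomic.
1-3: have /IA[AA' A'A] : forall x, x \in fv A -> l ⊢ Eq (s x) (t x)
  by move=> u uA; apply: st; rewrite mem_cat uA.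
1-3: have /IB[BB' B'B] : forall x, x \in fv B -> l ⊢ Eq (s x) (t x)
  by move=> u uB; apply: st; rewrite mem_cat uB orbT.
1-3: by split; [apply: sle_and|apply: sle_and]
     || (split; [apply: sle_or|apply: sle_or])
     || (split; [apply: sle_imp|apply: sle_imp]).
- by have [? ?] := IA _ _ _ st; split; apply: sle_neg.
all: pose w := above (map s (fv (All x A)) ++ map t (fv (All x A)) ++ list_fv l).
all: have := above_notin (map s (fv (All x A)) ++ map t (fv (All x A)) ++ list_fv l).
all: rewrite -/w !mem_cat !negb_or => /and3P[ws wt /fresh_in_fv wl].
all: have [sall sex] := seqv_inst_quant l IA ws.
all: have [tall tex] := seqv_inst_quant l IA wt.
all: have /IA/(seqv_quant wl)[qall qex] :
  forall y, y \in fv A -> l ⊢ Eq (update s x w y) (update t x w y).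
1,3: move=> y yA; rewrite /update; case: eqP => [_|/eqP yx]; first exact: nd_eq_refl.
1,2: by apply: st; rewrite mem_filter /= yx.
- exact: seqv_trans sall (seqv_trans qall (seqv_sym tall)).
- exact: seqv_trans sex (seqv_trans qex (seqv_sym tex)).
Qed.

Lemma seqv_inst_id l A : seqv l (inst id A) A.
Proof.
elim: A l => [y z|P ys|A IA B IB|A IA B IB|A IA B IB|A IA|x A IA|x A IA] l.
- exact: seqv_refl.
- suff -> : inst id (Rel P ys) = Rel P ys by apply: seqv_refl.
  by congr Rel; apply: val_inj; rewrite /= map_id.
1-3: have [[AA' A'A] [BB' B'B]] := (IA l, IB l).
- by split; apply: sle_and.
- by split; apply: sle_or.
- by split; apply: sle_imp.
- by have [? ?] := IA l; split; apply: sle_neg.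
all: have xx : x \notin map id (fv (All x A))
  by rewrite map_id mem_filter /= eqxx.
all: have [sall sex] := seqv_inst_quant l (@seqv_inst A) xx.
all: have updE : inst (update id x x) A = inst id A
  by apply: inst_ext => y _; rewrite /update; case: eqP.
all: have nilfresh : fresh_in x [::] by [].
all: have [qall qex] := seqv_quant nilfresh (IA [::]).
all: rewrite updE in sall sex.
- exact: seqv_trans sall (seqv_nil _ qall).
- exact: seqv_trans sex (seqv_nil _ qex).
Qed.

(** * Quantifier laws for substitution *)

(** The axiom [All z B -> B] already gives the instance at the bound variable
    [z] itself; replacement along [Eq z c] carries it to [c], and [z] then occurs
    only in that equation. *)
Lemma inst_all_elim l s x c A : l ⊢ Imp (inst s (All x A)) (inst (update s x c) A).
Proof.
apply: nd_nil; apply: nd_impI => /=; set z := above _; set B := inst _ A.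
have zA : z \notin map s (fv (All x A)) by apply: above_notin.
have dB : [:: All z B] ⊢ B by apply: (nd_allE (x := z)); apply: nd_hyp; left.
have [zc|zc] := eqVneq z c; first by rewrite -zc.
have zB : ~~ free z (inst (update s x c) A).
  rewrite freeE fv_inst; apply/mapP => -[y yA]; rewrite /update.
  case: eqP => [_ /eqP|/eqP yx zy]; first by rewrite (negPf zc).
  by move: zA; rewrite zy map_f // mem_filter /= yx.
apply: (nd_eq_elim (y := c) _ zB); first by apply: fresh_cons => //=; rewrite eqxx.
apply: (nd_mp (A := B)); last by apply: nd_weaken dB => C; right.
have [[d _] _] := seqv_inst (fun y (_ : y \in fv A) => eq_update_hyp s x z c y).
by apply: nd_weaken d => C [<-|[]]; left.
Qed.

Lemma inst_all_intro l s x c A : fresh_in c l -> c \notin map s (fv (All x A)) ->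
  l ⊢ inst (update s x c) A -> l ⊢ inst s (All x A).
Proof.
move=> cl cA dA; have [[_ [d _]] _] := seqv_inst_quant l (@seqv_inst A) cA.
by apply: nd_mp d _; apply: nd_allI.
Qed.

Lemma inst_ex_intro l s x c A : l ⊢ Imp (inst (update s x c) A) (inst s (Ex x A)).
Proof.
apply: nd_nil; apply: nd_impI => /=; set z := above _; set B := inst (update s x z) A.
have zA : z \notin map s (fv (All x A)) by apply: above_notin.
have [zc|zc] := eqVneq z c.
  by rewrite -zc; apply: nd_exI; apply: nd_hyp; left.
have zC : ~~ free z (inst (update s x c) A).
  rewrite freeE fv_inst; apply/mapP => -[y yA]; rewrite /update.
  case: eqP => [_ /eqP|/eqP yx zy]; first by rewrite (negPf zc).
  by move: zA; rewrite zy map_f // mem_filter /= yx.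
apply: (nd_eq_elim (x := z) (y := c)); [by apply: fresh_cons|by rewrite /= eqxx|].
apply: nd_exI; apply: (nd_mp (A := inst (update s x c) A)).
  have [_ [d _]] := seqv_inst (fun y (_ : y \in fv A) => eq_update_hyp s x z c y).
  by apply: nd_weaken d => C [<-|[]]; left.
by apply: nd_hyp; right; left.
Qed.

(** This takes the place of the instance of [A] at [c]: written with an equation,
    it needs no renaming of bound variables in [A]. *)
Definition witness z c A : form L := Ex z (And (Eq z c) A).

Lemma witness_elim l s x z c A : z \notin map s (fv (All x A)) -> c != z ->
  l ⊢ Imp (witness z c (inst (update s x z) A)) (inst (update s x c) A).
Proof.
move=> zA cz; apply: nd_nil; apply: nd_exE => //.
  rewrite freeE fv_inst; apply/mapP => -[y yA]; rewrite /update.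
  case: eqP => [_ /esym/eqP|/eqP yx zy]; first by rewrite (negPf cz).
  by move: zA; rewrite zy map_f // mem_filter /= yx.
set B := And _ _; have hB : [:: B] ⊢ B by apply: nd_hyp; left.
apply: nd_mp (nd_andr hB); apply: nd_cut (nd_andl hB) _.
have [[d _] _] := seqv_inst (fun y (_ : y \in fv A) => eq_update_hyp s x z c y).
by apply: nd_weaken d => C [<-|[]]; left.
Qed.

(** A premise about a new [c] is harmless. Since [z] may be free in [l] and [C],
    the elimination is performed on [c], after showing without any premises that
    [Ex z A] yields [Ex c (witness z c A)]. *)
Lemma witness_discharge l z c A C : fresh_in c l -> c != z -> ~~ free c A ->
  ~~ free c C -> witness z c A :: l ⊢ C -> l ⊢ Imp (Ex z A) C.
Proof.
move=> cl cz cA cC /(nd_exE cl cC); apply: nd_imp_trans; apply: nd_nil.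
apply: nd_exE => //=; first by rewrite eqxx /= andbF.
apply: (nd_eq_elim_r (x := c) (y := z)); [by apply: fresh_cons|by rewrite /= eqxx|].
by do 2 apply: nd_exI; apply: nd_andI; apply: nd_hyp; [left|right; left].
Qed.

Lemma In_mem (x : Ind) (V : seq Ind) : reflect (List.In x V) (x \in V).
Proof.
apply: (iffP idP); elim: V => [|y V IH] //=; rewrite inE.
  by case/orP => [/eqP ->|/IH]; [left|right].
by case=> [->|/IH ->]; rewrite ?eqxx ?orbT.
Qed.

(** As the [s x] are distinct, each occurs in a single equation. *)
Lemma nd_eqs_elim (V : seq Ind) s t B : injective s -> uniq V ->
  (forall x, x \in V -> ~~ free (s x) B) ->
  (forall x y, x \in V -> y \in V -> s x != t y) ->
  [seq Eq (s x) (t x) | x <- V] ⊢ B -> [::] ⊢ B.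
Proof.
move=> inj; elim: V => [//|x V IH] /= /andP[xV uV] sB st dB.
apply: IH => // [y yV|y y' yV y'V|].
- by apply: sB; rewrite inE yV orbT.
- by apply: st; rewrite inE ?yV ?y'V orbT.
apply: nd_eq_elim dB; last by apply: sB; rewrite inE eqxx.
move=> C /List.in_map_iff[y [<- yV]] /=.
move/In_mem: yV => yV.
rewrite negb_or (inj_eq inj) st ?inE ?eqxx ?yV ?orbT // andbT.
by apply: contraNneq xV => ->.
Qed.

Lemma nd_inst_disjoint s t A : injective s ->
  (forall x y, x \in fv A -> y \in fv A -> s x != t y) ->
  [::] ⊢ inst s A -> [::] ⊢ inst t A.
Proof.
move=> inj st dA; apply: (nd_eqs_elim (V := undup (fv A)) (s := s) (t := t)) => //.
- exact: undup_uniq.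
- move=> x; rewrite mem_undup => xA; rewrite freeE fv_inst.
  by apply/mapP => -[y yA] /eqP; rewrite (negPf (st _ _ xA yA)).
- by move=> x y; rewrite !mem_undup; apply: st.
suff /seqv_inst[[d _] _] : forall x, x \in fv A ->
    [seq Eq (s x) (t x) | x <- undup (fv A)] ⊢ Eq (s x) (t x).
  exact: nd_mp d (nd_nil _ dA).
move=> x; rewrite -mem_undup => xA; apply: nd_hyp; apply/List.in_map_iff; exists x; split=> //.
exact/In_mem.
Qed.

(** An injective renaming can be undone. Its values may clash with the original
    variables, which would lose information if they were simply identified with
    them; the way back therefore leads through variables beyond both. *)
Lemma nd_inst_injective s A : injective s -> [::] ⊢ inst s A -> [::] ⊢ A.
Proof.
move=> inj; pose N := above (map s (fv A) ++ fv A).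
have big x y : x \in map s (fv A) ++ fv A -> N + y != x.
  by move/ltn_above => xN; rewrite neq_ltn (leq_trans xN) ?leq_addr ?orbT.
move=> /(@nd_inst_disjoint s (addn N)) dN.
have [[d _] _] := seqv_inst_id [::] A; apply: nd_mp d _.
apply: (@nd_inst_disjoint (addn N)); first exact: addnI.
  by move=> x y xA yA; apply: big; rewrite mem_cat yA orbT.
apply: dN => // x y xA yA; rewrite eq_sym big // mem_cat map_f //.
Qed.

Lemma nd_disjI A B l : List.In A (B :: l) -> [:: A] ⊢ foldl (@Or L) B l.
Proof.
elim: l A B => [|C l IH] A B /=; first by case=> // <-; apply: nd_hyp; left.
have lift E : [:: Or B C] ⊢ E -> B = A \/ C = A -> [:: A] ⊢ E.
  move=> dE AE; apply: (nd_cut (A := Or B C)).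
    by case: AE => <-; [apply: nd_orl|apply: nd_orr]; apply: nd_hyp; left.
  by apply: nd_weaken dE => D [<-|[]]; left.
case=> [BA|[CA|lA]]; last by apply: IH; right.
  by apply: lift; [apply: IH; left|left].
by apply: lift; [apply: IH; left|right].
Qed.

Lemma nd_disjE l A m C : (forall D, List.In D (A :: m) -> l ⊢ Imp D C) ->
  l ⊢ Imp (foldl (@Or L) A m) C.
Proof.
elim: m A => [|D m IH] A dC /=; first by apply: dC; left.
apply: IH => E [<-|mE]; last by apply: dC; right; right.
by apply: nd_orE; apply: dC; [left|right; left].
Qed.

Implicit Types Gamma Delta : form L -> Prop.

(** * Entailment between sets of formulas *)

Definition entails Gamma Delta : Prop :=
  exists A m, List.Forall Delta (A :: m) /\ derivable Gamma (foldl (@Or L) A m).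

Lemma entails_cut Gamma Gamma' Delta :
  (forall A, Gamma A -> derivable Gamma' A) -> entails Gamma Delta -> entails Gamma' Delta.
Proof.
by move=> sub [A [m [Dm dm]]]; exists A, m; split=> //; apply: derivable_cut dm.
Qed.

Lemma entails_weaken Gamma Gamma' Delta :
  (forall A, Gamma A -> Gamma' A) -> entails Gamma Delta -> entails Gamma' Delta.
Proof. by move=> sub; apply: entails_cut => A /sub; apply: der_hyp. Qed.

Lemma entails_compact Gamma Delta : entails Gamma Delta ->
  exists l, List.Forall Gamma l /\ entails (fun B => List.In B l) Delta.
Proof.
move=> [A [m [Dm /compactness[l [Gl dl]]]]]; exists l; split=> //.
by exists A, m.
Qed.

Lemma derivable_nd Gamma l A : List.Forall Gamma l -> l ⊢ A -> derivable Gamma A.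
Proof. by move/List.Forall_forall => Gl; apply: derivable_weaken. Qed.

Definition add A Gamma : form L -> Prop := fun B => A = B \/ Gamma B.

(** The disjunctions of conclusions obtained from [A] and from [B] are both
    contained in the disjunction of all of them. *)
Lemma entails_or Gamma Delta A B : Gamma (Or A B) ->
  entails (add A Gamma) Delta -> entails (add B Gamma) Delta -> entails Gamma Delta.
Proof.
move=> GAB [A1 [m1 [D1 /deduction d1]]] [A2 [m2 [D2 /deduction d2]]].
exists A1, (m1 ++ A2 :: m2); split.
  by rewrite -cat_cons; apply (proj2 (List.Forall_app _ _ _)).
set C := foldl _ _ _.
have incl E F m : derivable Gamma (Imp E (foldl (@Or L) F m)) ->
    List.incl (F :: m) (A1 :: m1 ++ A2 :: m2) -> derivable Gamma (Imp E C).
  move=> dE sub; have dC : [::] ⊢ Imp (foldl (@Or L) F m) C.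
    apply: nd_disjE => X /sub X12; apply: nd_impI; exact: nd_disjI.
  apply: deduction; apply: (der_MP (phi := foldl (@Or L) F m)).
    apply: (der_MP (phi := E)); first by apply: der_hyp; left.
    by apply: derivable_weaken dE => X; right.
  by apply: derivable_weaken dC => X [].
have dA : derivable Gamma (Imp A C).
  by apply: incl d1 _ => X /=; rewrite List.in_app_iff; tauto.
have dB : derivable Gamma (Imp B C).
  by apply: incl d2 _ => X /=; rewrite List.in_app_iff /=; tauto.
apply: (der_MP (phi := Or A B)); first exact: der_hyp.
apply: der_MP dB _; apply: der_MP dA _; exact/der_prov/prov_ax/ax_or.
Qed.

Lemma fresh_disj x A m : fresh_in x (A :: m) -> ~~ free x (foldl (@Or L) A m).
Proof.
elim: m A => [|B m IH] A xm /=; first by apply: xm; left.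
apply: IH => C [<-|mC]; last by apply: xm; right; right.
by rewrite /= negb_or; apply/andP; split; apply: xm; [left|right; left].
Qed.

Lemma entails_witness Gamma Delta z c A :
  (forall B, Gamma B -> ~~ free c B) -> (forall B, Delta B -> ~~ free c B) -> c != z ->
  Gamma (Ex z A) -> entails (add (witness z c A) Gamma) Delta -> entails Gamma Delta.
Proof.
move=> cG cD cz GA [B [m [Dm /deduction/compactness[l [Gl dl]]]]].
have cl : fresh_in c l by move/List.Forall_forall: Gl => Gl E /Gl /cG.
have {}cD : fresh_in c (B :: m) by move/List.Forall_forall: Dm => Dm E /Dm /cD.
have cA : ~~ free c A by move: (cG _ GA); rewrite /= cz.
exists B, m; split=> //; apply: (der_MP (der_hyp GA)).
by apply: derivable_nd Gl (witness_discharge cl cz cA (fresh_disj cD) (nd_impE dl)).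
Qed.

(** * Levels of variables *)

(** Each value is taken infinitely often, so that every extension of a theory to
    the next level finds new variables there. *)
Definition level (x : Ind) : nat := logn 2 x.+1.

Definition var_of_level (k m : nat) : Ind := (2 ^ k * (2 * m).+1).-1.

Lemma var_of_levelS k m : (var_of_level k m).+1 = 2 ^ k * (2 * m).+1.
Proof. by rewrite prednK // muln_gt0 expn_gt0. Qed.

Lemma level_var k m : level (var_of_level k m) = k.
Proof.
rewrite /level var_of_levelS lognM ?expn_gt0 // pfactorK // logn_coprime ?addn0 //.
by rewrite coprime2n /= mul2n odd_double.
Qed.

Lemma leq_var k m : m <= var_of_level k m.
Proof.
rewrite -ltnS var_of_levelS (leq_trans (n := (2 * m).+1)) ?leq_pmull ?expn_gt0 //.
by rewrite ltnS leq_pmull.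
Qed.

Definition in_level k A : bool := all (fun x => level x < k) (fv A).

Lemma in_levelW k k' A : k <= k' -> in_level k A -> in_level k' A.
Proof. by move=> kk'; apply: sub_all => x /= /leq_trans; apply. Qed.

Lemma in_level_fresh c k A : k <= level c -> in_level k A -> ~~ free c A.
Proof.
move=> kc /allP Ak; rewrite freeE; apply/negP => /Ak; by rewrite ltnNge kc.
Qed.

Lemma in_level_inst k s A :
  (forall x, x \in fv A -> level (s x) < k) -> in_level k (inst s A).
Proof. by move=> sk; rewrite /in_level fv_inst all_map; apply/allP. Qed.

(** Finitely many premises and conclusions make up one formula, and substitution
    commutes with forming it; so it suffices to undo a renaming in a theorem. *)
Lemma entails_inst s Gamma Delta : injective s ->
  entails (fun B => exists A, Gamma A /\ B = inst s A)
          (fun B => exists A, Delta A /\ B = inst s A) ->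
  entails Gamma Delta.
Proof.
move=> inj [B [m [Dm /compactness[l [Gl dl]]]]].
have preimage (X : form L -> Prop) r :
    List.Forall (fun B => exists A, X A /\ B = inst s A) r ->
    exists r', List.Forall X r' /\ r = map (inst s) r'.
  elim=> [|_ q [A [XA ->]] _ [q' [Xq' ->]]]; first by exists [::].
  by exists (A :: q'); split=> //; constructor.
have [[|A m'] [DA // [eB em]]] := preimage _ _ Dm.
have [l' [Gl' el]] := preimage _ _ Gl.
exists A, m'; split=> //; apply: (derivable_nd Gl').
have disjE C r : foldl (@Or L) (inst s C) (map (inst s) r) = inst s (foldl (@Or L) C r).
  by elim: r C => [|E r IH] C //=; rewrite -IH.
move: dl; rewrite eB em disjE el -/(nd _ _); move: (foldl _ _ _) => C.
elim: l' {el Gl'} C => [|E l' IH] C /= dC; first exact: nd_inst_injective inj dC.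
by apply: nd_impE; apply: (IH (Imp E C)); apply: nd_impI.
Qed.

End NaturalDeduction.

(** * Enumeration of the formulas *)

Section Coding.
Variables (L : signature) (symbol_code : L -> nat).
Hypothesis symbol_code_inj : injective symbol_code.

Fixpoint form_tree (A : form L) : GenTree.tree nat :=
  match A with
  | Eq x y => GenTree.Node 0 [:: GenTree.Leaf x; GenTree.Leaf y]
  | Rel P xs => GenTree.Node 1 (map (@GenTree.Leaf nat) (symbol_code P :: xs))
  | And B C => GenTree.Node 2 [:: form_tree B; form_tree C]
  | Or B C => GenTree.Node 3 [:: form_tree B; form_tree C]
  | Imp B C => GenTree.Node 4 [:: form_tree B; form_tree C]
  | Neg B => GenTree.Node 5 [:: form_tree B]
  | All x B => GenTree.Node 6 [:: GenTree.Leaf x; form_tree B]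
  | Ex x B => GenTree.Node 7 [:: GenTree.Leaf x; form_tree B]
  end.

Lemma form_tree_inj : injective form_tree.
Proof.
elim=> [x y|P xs|A IA B IB|A IA B IB|A IA B IB|A IA|x A IA|x A IA] [] //=.
- by move=> x' y' [-> ->].
- move=> Q ys [/symbol_code_inj PQ]; case: Q / PQ ys => ys /inj_map xy.
  by congr Rel; apply/val_inj/xy => ? ? [].
- by move=> A' B' [/IA -> /IB ->].
- by move=> A' B' [/IA -> /IB ->].
- by move=> A' B' [/IA -> /IB ->].
- by move=> A' [/IA ->].
- by move=> x' A' [-> /IA ->].
- by move=> x' A' [-> /IA ->].
Qed.

Lemma form_enumeration : exists e : nat -> option (form L), forall A, exists n, e n = Some A.
Proof.
pose code A := pickle (form_tree A).
have code_inj : injective code.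
  by move=> A B /(pcan_inj (@pickleK _)); apply: form_tree_inj.
exists (fun n => if excluded_middle_informative (exists A, code A = n) is left ex
  then Some (sval (constructive_indefinite_description _ ex)) else None).
move=> A; exists (code A); case: excluded_middle_informative => [ex|[]]; last by exists A.
by case: constructive_indefinite_description => B /= /code_inj ->.
Qed.

End Coding.

(** * Prime theories with witnesses *)

Section Theories.
Variable L : signature.
Implicit Types (A B : form L) (l : seq (form L)) (Gamma Delta : form L -> Prop).

Local Notation "l ⊢ A" := (nd l A) (at level 70).

(** A world of the canonical sheaf. The set of all formulas of a level is among
    them; it is what satisfies all premises when there are no conclusions. *)
Record theory := Theory {
  rank : nat;
  holds : form L -> Prop;
  rank_gt0 : 0 < rank;
  holds_in_level : forall A, holds A -> in_level rank A;
  holds_closed : forall A, in_level rank A -> derivable holds A -> holds A;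
  holds_prime : forall A B, holds (Or A B) -> holds A \/ holds B;
  holds_witness : forall z A, holds (Ex z A) -> exists2 c, c != z & holds (witness z c A)
}.

Section Extension.
Variable e : nat -> option (form L).
Hypothesis e_surj : forall A, exists n, e n = Some A.
Variables (k : nat) (Gamma Delta : form L -> Prop).
Hypothesis Gamma_k : forall A, Gamma A -> in_level k A.
Hypothesis Delta_k : forall A, Delta A -> in_level k A.
Hypothesis consistent : ~ entails Gamma Delta.

Definition with_list l : form L -> Prop := fun A => List.In A l \/ Gamma A.

Definition new_var z A l : Ind :=
  var_of_level k (above (z :: list_fv (Ex z A :: l))).

Definition witnesses l A :=
  if A is Ex z B then [:: witness z (new_var z B l) B] else [::].

Definition addable l A : Prop :=
  in_level k.+1 A /\ ~ entails (with_list (A :: l)) Delta.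

Definition extend l (o : option (form L)) :=
  if o is Some A then
    if excluded_middle_informative (addable l A) is left _
    then witnesses l A ++ A :: l else l
  else l.

Fixpoint stage n := if n is m.+1 then extend (stage m) (e m) else [::].

Lemma extend_incl l o : List.incl l (extend l o).
Proof.
move=> B lB; rewrite /extend; case: o => [A|//].
case: excluded_middle_informative => // _.
by apply/List.in_app_iff; right; right.
Qed.

Lemma stage_incl m n : m <= n -> List.incl (stage m) (stage n).
Proof.
elim: n => [|n IH]; first by rewrite leqn0 => /eqP ->.
rewrite leq_eqVlt => /predU1P[-> //|/IH sub] A /sub; exact: extend_incl.
Qed.

(** Adding a witness cannot make a conclusion derivable: its variable is new for
    the stage and has level [k], hence is absent from [Gamma] and [Delta]. *)
Lemma stage_ok n : (forall A, List.In A (stage n) -> in_level k.+1 A) /\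
  ~ entails (with_list (stage n)) Delta.
Proof.
elim: n => [|n [lev cons]] /=.
  by split=> // ent; apply: consistent; apply: entails_weaken ent => A [].
rewrite /extend; case: (e n) => [A|//]; case: excluded_middle_informative => // -[Ak consA].
have Alev B : List.In B (A :: stage n) -> in_level k.+1 B by case=> [<-|/lev].
case: A Ak consA Alev => // z A Ak consA Alev.
set s := stage n in lev cons consA Alev *; rewrite /=.
set c := new_var z A s.
have [clev cbig] : level c = k /\ above (z :: list_fv (Ex z A :: s)) <= c.
  by rewrite level_var leq_var.
have cnew x : x \in z :: list_fv (Ex z A :: s) -> c != x.
  by move/ltn_above => xc; rewrite neq_ltn (leq_trans xc) ?orbT.
have cz : c != z by apply: cnew; rewrite inE eqxx.
split.
  move=> B [<-|]; last exact: Alev.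
  rewrite /in_level /= eqxx /= (negPf cz) /= clev ltnSn /=.
  exact: Ak.
move=> ent; apply: consA; apply: (entails_witness (c := c) (z := z) (A := A)) => //.
- move=> B [sB|/Gamma_k]; last by apply: in_level_fresh; rewrite clev.
  apply: fresh_in_fv sB; apply/negP => cs; have := cnew c; rewrite eqxx inE cs orbT.
  by move/(_ isT).
- by move=> B /Delta_k; apply: in_level_fresh; rewrite clev.
- by left; left.
by apply: entails_weaken ent => B [[<-|sB]|GB]; [left|right; left|right; right].
Qed.

Definition limit : form L -> Prop := fun A => Gamma A \/ exists n, List.In A (stage n).

Lemma limit_consistent : ~ entails limit Delta.
Proof.
move/entails_compact => [l [liml ent]].
suff [n sub] : exists n, forall A, List.In A l -> with_list (stage n) A.
  by have [_ []] := stage_ok n; apply: entails_weaken ent.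
elim: liml => [|A {ent}l limA _ [n sub]]; first by exists 0.
have [m Am] : exists m, with_list (stage m) A.
  by case: limA => [GA|[m mA]]; [exists 0; right|exists m; left].
exists (maxn m n) => B [<-|/sub].
  by case: Am => [mA|]; [left; apply: stage_incl mA; rewrite leq_maxl|right].
by case=> [nB|]; [left; apply: stage_incl nB; rewrite leq_maxr|right].
Qed.

Lemma limit_addable A n : e n = Some A -> in_level k.+1 A ->
  ~ entails (add A limit) Delta ->
  addable (stage n) A.
Proof.
move=> eA Ak ent; split=> // ent'; apply: ent; apply: entails_weaken ent' => B.
by case=> [[<-|nB]|GB]; [left|right; right; exists n|right; left].
Qed.

Lemma limit_maximal A : in_level k.+1 A -> ~ limit A -> entails (add A limit) Delta.
Proof.
move=> Ak limA; apply: NNPP => ent; apply: limA; right.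
have [n eA] := e_surj A; exists n.+1; rewrite /= eA /=.
case: excluded_middle_informative => [_|[]]; last exact: limit_addable.
by apply/List.in_app_iff; right; left.
Qed.

Lemma limit_in_level A : limit A -> in_level k.+1 A.
Proof.
case=> [/Gamma_k|[n /(proj1 (stage_ok n))//]]; exact: in_levelW.
Qed.

Lemma limit_witness z A : limit (Ex z A) ->
  exists2 c, c != z & limit (witness z c A).
Proof.
move=> limA; have [n eA] := e_surj (Ex z A).
have addA : addable (stage n) (Ex z A).
  apply: limit_addable => //; first exact: limit_in_level.
  move=> ent; apply: limit_consistent; by apply: entails_weaken ent => B [<-|].
exists (new_var z A (stage n)); last first.
  right; exists n.+1; rewrite /= eA /=.
  by case: excluded_middle_informative => // _; left.
have zc : z < new_var z A (stage n).
  by apply: leq_trans (leq_var _ _); apply: ltn_above; rewrite inE eqxx.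
by rewrite neq_ltn zc orbT.
Qed.

Lemma limit_prime A B : limit (Or A B) -> limit A \/ limit B.
Proof.
move=> limAB; apply: NNPP => /not_or_and[nA nB]; apply: limit_consistent.
have := limit_in_level limAB; rewrite /in_level /= all_cat => /andP[Ak Bk].
exact: entails_or limAB (limit_maximal Ak nA) (limit_maximal Bk nB).
Qed.

Lemma limit_closed A : in_level k.+1 A -> derivable limit A -> limit A.
Proof.
move=> Ak dA; apply: NNPP => /(limit_maximal Ak) ent; apply: limit_consistent.
by apply: entails_cut ent => B [<-//|]; apply: der_hyp.
Qed.

Lemma theory_extension : exists w : theory,
  [/\ rank w = k.+1, forall A, Gamma A -> holds w A & forall A, Delta A -> ~ holds w A].
Proof.
exists (@Theory k.+1 limit (ltn0Sn k) limit_in_level limit_closed limit_prime limit_witness).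
split=> // [A GA|A DA limA]; first by left.
by apply: limit_consistent; exists A, [::]; split; [constructor|apply: der_hyp].
Qed.

End Extension.
End Theories.

(** * Soundness *)

Section Soundness.
Variables (Omega : Pi -> Prop) (S : sheaf Omega).
Implicit Types (A B C : FO Omega) (x y z : Ind) (s : sign).

Lemma push_refl (w : W S) (ww : preceq w w) (f : Ind -> U w) : push ww f = f.
Proof. by apply: functional_extensionality => x; apply: H_id. Qed.

Lemma push_trans (w v u : W S) (wv : preceq w v) (vu : preceq v u) (wu : preceq w u)
  (f : Ind -> U w) : push vu (push wv f) = push wu f.
Proof. by apply: functional_extensionality => x; apply: H_comp. Qed.

Lemma push_update (w v : W S) (wv : preceq w v) (f : Ind -> U w) x a :
  push wv (update f x a) = update (push wv f) x (H wv a).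
Proof.
by apply: functional_extensionality => y; rewrite /push /update; case: eqP.
Qed.

Lemma sat_ext A s (w : W S) (f g : Ind -> U w) :
  (forall x, free x A -> f x = g x) -> sat s A f -> sat s A g.
Proof.
have upd x B (v : W S) (f' g' : Ind -> U v) (a : U v) :
    (forall y, (y != x) && free y B -> f' y = g' y) ->
    forall y, free y B -> update f' x a y = update g' x a y.
  by move=> fg y yB; rewrite /update; case: eqP => // /eqP yx; apply: fg; rewrite yx.
have psh (w1 v1 : W S) (wv : preceq w1 v1) (P : pred Ind) (f' g' : Ind -> U w1) :
    (forall y, P y -> f' y = g' y) -> forall y, P y -> push wv f' y = push wv g' y.
  by move=> fg y /fg; rewrite /push => ->.
elim: A s w f g => [y z|P ys|A IA B IB|A IA B IB|A IA B IB|A IA|z A IA|z A IA] s w f g fg /=.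
- by case: s => /=; rewrite !fg //= eqxx ?orbT.
- have -> : map_tuple f ys = map_tuple g ys by apply/val_inj/eq_in_map.
  by case: s.
1-3: have fgA y (yA : free y A) : f y = g y by apply: fg; rewrite /= yA.
1-3: have fgB y (yB : free y B) : f y = g y by apply: fg; rewrite /= yB orbT.
1-3: have gfA y (yA : free y A) : g y = f y by rewrite fgA.
- by case: s => -[]; [move=> /(IA _ _ _ _ fgA) ? /(IB _ _ _ _ fgB)
    |left; apply: IA fgA _|right; apply: IB fgB _].
- by case: s => -[]; [left; apply: IA fgA _|right; apply: IB fgB _
    |move=> /(IA _ _ _ _ fgA) ? /(IB _ _ _ _ fgB)].
- case: s => [AB v wv|[/(IA _ _ _ _ fgA) ? /(IB _ _ _ _ fgB)] //].
  case: (AB v wv) => [nA|B1]; [left|right].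
    by apply: contra_not nA; apply: IA; apply: psh gfA.
  by apply: IB B1; apply: psh fgB.
- by case: s; apply: IA.
- case: s => [AB v wv a|[a Aa]].
    by apply: IA (AB v wv a); apply: upd; apply: (psh _ _ _ (fun y => _)) fg.
  by exists a; apply: IA Aa; apply: upd.
- case: s => [[a Aa]|AB v wv a].
    by exists a; apply: IA Aa; apply: upd.
  by apply: IA (AB v wv a); apply: upd; apply: (psh _ _ _ (fun y => _)) fg.
Qed.

Lemma sat_mono A s (w v : W S) (wv : preceq w v) (f : Ind -> U w) :
  sat s A f -> sat s A (push wv f).
Proof.
elim: A s w v wv f => [y z|P ys|A IA B IB|A IA B IB|A IA B IB|A IA|z A IA|z A IA]
  s w v wv f /=.
- case: s => [|/(H_neg wv) /=]; first by rewrite /push => ->.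
  by congr Mneg; apply: val_inj.
- have mapE : map_tuple (push wv f) ys = map_tuple (H wv) (map_tuple f ys).
    by apply: val_inj; rewrite /= -map_comp.
  by rewrite mapE; case: s; [apply: H_pos|apply: H_neg].
- case: s => /= [[a b]|[a|b]]; first by split; [apply: IA|apply: IB].
    by left; apply: IA.
  by right; apply: IB.
- case: s => /= [[a|b]|[a b]]; last by split; [apply: IA|apply: IB].
    by left; apply: IA.
  by right; apply: IB.
- case: s => [AB u vu|[? ?]]; last by split; [apply: IA|apply: IB].
  by have := AB u (preceq_trans wv vu); rewrite (push_trans wv vu (preceq_trans wv vu)).
- by case: s; apply: IA.
- case: s => [AB u vu a|[a Aa]].
    by have := AB u (preceq_trans wv vu) a; rewrite (push_trans wv vu (preceq_trans wv vu)).
  by exists (H wv a); rewrite -push_update; apply: IA.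
- case: s => [[a Aa]|AB u vu a].
    by exists (H wv a); rewrite -push_update; apply: IA.
  by have := AB u (preceq_trans wv vu) a; rewrite (push_trans wv vu (preceq_trans wv vu)).
Qed.

Lemma update_rename (T : Type) (f : Ind -> T) x y z :
  f (rename x y z) = update f x (f y) z.
Proof. by rewrite /rename /update; case: eqP. Qed.

Lemma subst_not_free A x y : ~~ free x A -> subst x y A = A.
Proof.
have r z : x != z -> rename x y z = z by rewrite /rename eq_sym => /negPf ->.
elim: A => [u v|P us|A IA B IB|A IA B IB|A IA B IB|A IA|z A IA|z A IA] /=;
  rewrite ?negb_or.
- by case/andP => /r -> /r ->.
- move=> xus; congr Rel; apply: val_inj; rewrite /= -[RHS]map_id.
  by apply/eq_in_map => z zus; apply: r; apply: contraNneq xus => ->.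
1-3: by case/andP => /IA -> /IB ->.
- by move/IA ->.
all: by rewrite (eq_sym z); case: eqVneq => //= _ /IA ->.
Qed.

Lemma sat_subst A x y s (w : W S) (f : Ind -> U w) : substitutable y x A ->
  sat s (subst x y A) f <-> sat s A (update f x (f y)).
Proof.
have absent B s' (v : W S) (g : Ind -> U v) : ~~ free x B ->
    sat s' (subst x y B) g <-> sat s' B (update g x (g y)).
  move=> xB; rewrite subst_not_free //.
  by split; apply: sat_ext => z zB; rewrite /update; case: eqP zB xB => // -> ->.
have swap z (v : W S) (g : Ind -> U v) a : z != x -> z != y ->
    update (update g z a) x (update g z a y) = update (update g x (g y)) z a.
  move=> zx zy; apply: functional_extensionality => u; rewrite /update (eq_sym y).
  by rewrite (negPf zy); case: (eqVneq u x) => // ->; rewrite eq_sym (negPf zx).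
have quant z B (Q : Ind -> FO Omega -> FO Omega) : (Q = @All _ \/ Q = @Ex _) ->
    substitutable y x (Q z B) -> free x (Q z B) ->
    [/\ z != x, z != y, substitutable y x B & subst x y (Q z B) = Q z (subst x y B)].
  by case=> -> /= + xB; rewrite xB /= => /andP[? ?];
    case/andP: xB => /negPf xz _; rewrite eq_sym xz.
elim: A s w f => [u v|P us|A IA B IB|A IA B IB|A IA B IB|A IA|z A IA|z A IA] s w f.
- by move=> _; case: s; rewrite /= !update_rename.
- move=> _ /=.
  have -> : map_tuple f (map_tuple (rename x y) us) = map_tuple (update f x (f y)) us.
    by apply: val_inj; rewrite /= -map_comp; apply: eq_map => u /=; apply: update_rename.
  by case: s.
- by case/andP=> sA sB; case: s => /=; rewrite IA // IB.
- by case/andP=> sA sB; case: s => /=; rewrite IA // IB.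
- case/andP=> sA sB; case: s => /=; last by rewrite IA // IB.
  by split=> AB v wv; have := AB v wv; rewrite push_update IA // IB.
- by move=> sA; case: s => /=; apply: IA.
- move=> sA; have [xA|xA] := boolP (free x (All z A)); last exact: absent.
  have [zx zy sA' subE] := quant z A (@All _) (or_introl erefl) sA xA.
  rewrite subE; case: s => /=.
    by split=> h v wv a; have := h v wv a; rewrite IA // swap // push_update.
  by split=> -[a h]; exists a; move: h; rewrite IA // swap.
- move=> sA; have [xA|xA] := boolP (free x (Ex z A)); last exact: absent.
  have [zx zy sA' subE] := quant z A (@Ex _) (or_intror erefl) sA xA.
  rewrite subE; case: s => /=; last first.
    by split=> h v wv a; have := h v wv a; rewrite IA // swap // push_update.
  by split=> -[a h]; exists a; move: h; rewrite IA // swap.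
Qed.

Lemma sat_imp A B (w : W S) (f : Ind -> U w) : sat pos (Imp A B) f <->
  forall v (wv : preceq w v), sat pos A (push wv f) -> sat pos B (push wv f).
Proof.
split=> [h v wv Av|h v wv]; first by case: (h v wv).
by case: (classic (sat pos A (push wv f))) => [/h|]; [right|left].
Qed.

Lemma sat_imp_here A B (w : W S) (f : Ind -> U w) :
  sat pos (Imp A B) f -> sat pos A f -> sat pos B f.
Proof. by move/sat_imp/(_ w (preceq_refl w)); rewrite push_refl. Qed.

Lemma sat_iff A B : (forall (w : W S) (f : Ind -> U w), sat pos A f <-> sat pos B f) ->
  forall (w : W S) (f : Ind -> U w), sat pos (Iff A B) f.
Proof. by move=> AB w f; split; apply/sat_imp => v wv /AB. Qed.

Lemma axiom_sound A (w : W S) (f : Ind -> U w) : axiom A -> sat pos A f.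
Proof.
case=> {A} [A B|A B C|A B|A B|A B|A B|A B|A B C|x y A yA|x y A yA|x|x y z A yA zA|
  A|A B|A B|A B|x A|x A].
- apply/sat_imp => v wv Av; apply/sat_imp => u vu _; exact: sat_mono.
- apply/sat_imp => v wv ABC; apply/sat_imp => u vu AB; apply/sat_imp => t ut At.
  have Bt := sat_imp_here (sat_mono ut AB) At.
  have BCt := sat_imp_here (sat_mono ut (sat_mono vu ABC)) At.
  exact: sat_imp_here BCt Bt.
- by apply/sat_imp => v wv [].
- by apply/sat_imp => v wv [].
- apply/sat_imp => v wv Av; apply/sat_imp => u vu Bu; split=> //; exact: sat_mono.
- by apply/sat_imp => v wv; left.
- by apply/sat_imp => v wv; right.
- apply/sat_imp => v wv AC; apply/sat_imp => u vu BC; apply/sat_imp => t ut [At|Bt].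
    exact: sat_imp_here (sat_mono ut (sat_mono vu AC)) At.
  exact: sat_imp_here (sat_mono ut BC) Bt.
- apply/sat_imp => v wv /(_ v (preceq_refl v) (push wv f y)).
  by rewrite push_refl => ?; apply/sat_subst.
- by apply/sat_imp => v wv /(sat_subst _ _ yA) Ay; exists (push wv f y).
- by [].
- apply/sat_imp => v wv /= yz; apply/sat_imp => u vu /(sat_subst _ _ yA) Ay.
  apply/sat_subst => //; suff <- : push vu (push wv f) y = push vu (push wv f) z by [].
  by rewrite -![push vu _ _]/(H vu _) yz.
- exact: sat_iff.
- exact: sat_iff.
- exact: sat_iff.
- exact: sat_iff.
- exact: sat_iff.
- exact: sat_iff.
Qed.

(** The eigenvariable [y] of a quantifier rule is given an arbitrary value of an
    arbitrary later world; this does not affect a formula without free [y]. *)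
Lemma sat_eigenvariable A x y (w : W S) (f : Ind -> U w) a :
  substitutable y x A -> ~~ free y (All x A) ->
  sat pos (subst x y A) (update f y a) <-> sat pos A (update f x a).
Proof.
move=> yA nyA; apply: iff_trans (sat_subst _ _ yA) _.
have eqf z : free z A -> update (update f y a) x (update f y a y) z = update f x a z.
  rewrite /update eqxx; case: (eqVneq z x) => // zx; case: (eqVneq z y) => // zy.
  by move: nyA; rewrite /= -zy zx /= => /negPf ->.
split; apply: sat_ext => z zA; first exact: eqf.
by rewrite eqf.
Qed.

Lemma sat_update_not_free A y s (w : W S) (f : Ind -> U w) a : ~~ free y A ->
  sat s A (update f y a) <-> sat s A f.
Proof.
by move=> yA; split; apply: sat_ext => z zA; rewrite /update; case: eqP zA yA => // -> ->.
Qed.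

Lemma provable_sound A (w : W S) (f : Ind -> U w) : provable A -> sat pos A f.
Proof.
move=> pA; elim: pA w f => {A} [A aA|A B _ IA _ IAB|
  x y A B yA yB nyA _ IH|x y A B yA yB nyA _ IH] w f.
- exact: axiom_sound.
- exact: sat_imp_here (IAB w f) (IA w f).
- apply/sat_imp => v wv Bv u vu a; apply/(sat_eigenvariable _ _ yA nyA).
  by apply: sat_imp_here (IH _ _) _; apply/sat_update_not_free/sat_mono.
- apply/sat_imp => v wv [a /(sat_eigenvariable _ _ yA nyA)/(sat_imp_here (IH _ _))].
  by move/sat_update_not_free; apply.
Qed.

Lemma derivable_sound Gamma A (w : W S) (f : Ind -> U w) :
  (forall B, Gamma B -> sat pos B f) -> derivable Gamma A -> sat pos A f.
Proof.
move=> sG; elim=> [B /sG//|B /provable_sound//|B C _ sB _ sBC].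
exact: sat_imp_here sBC sB.
Qed.

Lemma sat_disj A m (w : W S) (f : Ind -> U w) : sat pos (foldl (@Or _) A m) f ->
  exists2 B, List.In B (A :: m) & sat pos B f.
Proof.
elim: m A => [|B m IH] A /=; first by exists A => //; left.
case/IH => C [<- [|]|mC] sC; [exists A|exists B|exists C] => //; first by left.
  by right; left.
by right; right.
Qed.

End Soundness.

(** * Logical operations in theories *)

Section Membership.
Variable L : signature.
Variable e : nat -> option (form L).
Hypothesis e_surj : forall A, exists n, e n = Some A.
Implicit Types (A B C D : form L) (l : seq (form L)) (w v : theory L).

Local Notation "l ⊢ A" := (nd l A) (at level 70).

Definition below w v : Prop := rank w <= rank v /\ forall A, holds w A -> holds v A.

Lemma below_refl w : below w w.
Proof. by split. Qed.

Lemma below_trans w v u : below w v -> below v u -> below w u.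
Proof.
by move=> [rwv mwv] [rvu mvu]; split; [apply: leq_trans rwv rvu|move=> A /mwv/mvu].
Qed.

Lemma holds_nd w l A : List.Forall (holds w) l -> in_level (rank w) A -> l ⊢ A -> holds w A.
Proof. by move=> wl Aw dA; apply: holds_closed Aw (derivable_nd wl dA). Qed.

Lemma holds_imp w A B : in_level (rank w) B -> [::] ⊢ Imp A B -> holds w A -> holds w B.
Proof.
move=> Bw dAB Aw; apply: (holds_nd (l := [:: A])) Bw _; first by constructor; [|constructor].
exact: nd_impE.
Qed.

Lemma holds_iff w A B : axiom (Iff A B) -> in_level (rank w) A -> in_level (rank w) B ->
  holds w A <-> holds w B.
Proof. by move=> AB Aw Bw; split; apply: holds_imp => //; [apply: nd_iffl|apply: nd_iffr]. Qed.

Lemma in_level_cat k A B C : fv C = fv A ++ fv B ->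
  in_level k C -> in_level k A /\ in_level k B.
Proof. by rewrite /in_level => ->; rewrite all_cat => /andP. Qed.

Lemma holds_and w A B : holds w (And A B) <-> holds w A /\ holds w B.
Proof.
split=> [AB|[wA wB]].
  have [Aw Bw] := @in_level_cat _ A B (And A B) erefl (holds_in_level AB).
  by split; apply: holds_imp AB => //; apply: nd_ax; [apply: ax_andl|apply: ax_andr].
apply: (holds_nd (l := [:: A; B])); first by do ! constructor.
  by rewrite /in_level /= all_cat; apply/andP; split; apply: holds_in_level.
by apply: nd_andI; apply: nd_hyp; [left|right; left].
Qed.

Lemma holds_or w A B : in_level (rank w) A -> in_level (rank w) B ->
  holds w (Or A B) <-> holds w A \/ holds w B.
Proof.
move=> Aw Bw; have ABw : in_level (rank w) (Or A B) by rewrite /in_level all_cat; apply/andP.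
split=> [/holds_prime//|[|]]; apply: holds_imp => //; apply: nd_ax.
  exact: ax_orl.
exact: ax_orr.
Qed.

Lemma entails_single Gamma A : entails Gamma (eq A) -> derivable Gamma A.
Proof.
move=> [B [m [Bm dm]]]; have dA : [::] ⊢ Imp (foldl (@Or L) B m) A.
  apply: nd_disjE => C; move/List.Forall_forall: Bm => /(_ C) BC /BC <-.
  exact: nd_imp_refl.
by apply: der_MP dm _; apply: derivable_weaken dA.
Qed.

(** If [A] together with [w] does not derive [B], some extension of [w] contains
    [A] but not [B]. *)
Lemma holds_arrow w A B : in_level (rank w) (Imp A B) ->
  holds w (Imp A B) <-> forall v, below w v -> holds v A -> holds v B.
Proof.
move=> ABw; have [Aw Bw] := @in_level_cat _ A B (Imp A B) erefl ABw; split.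
  move=> AB v [rwv mwv] vA; apply: (holds_nd (l := [:: A; Imp A B])).
  - by do ! constructor => //; apply: mwv.
  - exact: in_levelW Bw.
  - by apply: (nd_mp (A := A)); apply: nd_hyp; [right; left|left].
move=> h; apply: NNPP => nAB.
have Gw C : add A (holds w) C -> in_level (rank w) C by case=> [<-//|/holds_in_level].
have Dw C : B = C -> in_level (rank w) C by move=> <-.
have [|v [rv mv nv]] := theory_extension e_surj Gw Dw.
  by move/entails_single/deduction => dAB; apply/nAB/holds_closed.
apply: (nv B) => //; apply: h; last by apply: mv; left.
by split; [rewrite rv|move=> C wC; apply: mv; right].
Qed.

Lemma in_level_update k s x c A : in_level k (inst s (All x A)) -> level c < k ->
  in_level k (inst (update s x c) A).
Proof.
rewrite /in_level fv_inst fv_inst !all_map => /allP sk ck; apply/allP => y yA /=.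
rewrite /update; case: eqP => // /eqP yx; apply: sk.
by rewrite mem_filter /= yx.
Qed.

(** The first variable [c] of level [rank w] does not occur in [w], so an
    instance at [c] that were derivable from [w] could be generalized. A world
    omitting that instance lies two levels up, since [c] itself uses one. *)
Lemma holds_all w s x A : in_level (rank w) (inst s (All x A)) ->
  holds w (inst s (All x A)) <->
  forall v, below w v -> forall c, level c < rank v -> holds v (inst (update s x c) A).
Proof.
move=> Aw; split.
  move=> wA v [rwv mwv] c cv; apply: holds_imp (mwv _ wA); last exact: inst_all_elim.
  by apply: in_level_update cv; apply: in_levelW Aw.
move=> h; apply: NNPP => nA; pose c := var_of_level (rank w) 0.
have levc : level c = rank w by apply: level_var.
have Gw C : holds w C -> in_level (rank w).+1 C.
  by move/holds_in_level; apply: in_levelW.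
have Dw C : inst (update s x c) A = C -> in_level (rank w).+1 C.
  by move=> <-; apply: in_level_update; rewrite ?levc //; apply: in_levelW Aw.
have [|v [rv mv nv]] := theory_extension e_surj Gw Dw.
  move/entails_single/compactness => [l [wl dl]]; apply/nA/(holds_nd wl) => //.
  apply: inst_all_intro dl.
    move=> C lC; apply: (in_level_fresh (k := rank w)); rewrite ?levc //.
    by apply: holds_in_level; move/List.Forall_forall: wl; apply.
  rewrite -fv_inst; apply/negP => cA; move/allP: Aw => /(_ c cA).
  by rewrite levc ltnn.
apply: (nv _ erefl); apply: h; last by rewrite rv levc ltnW.
by split; [rewrite rv ltnW|].
Qed.

Lemma holds_ex w s x A : in_level (rank w) (inst s (Ex x A)) ->
  holds w (inst s (Ex x A)) <->
  exists2 c, level c < rank w & holds w (inst (update s x c) A).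
Proof.
move=> Aw; split; last by case=> c _; apply: holds_imp Aw (inst_ex_intro _ _ _ _ _).
move=> wA; have [c cz wc] := holds_witness wA; have /= cA := holds_in_level wc.
have cw : level c < rank w.
  by move: cA; rewrite /in_level /= eqxx /= (negPf cz) => /andP[].
exists c => //; apply: holds_imp wc; first exact: (@in_level_update _ s x c A).
by apply: witness_elim cz; apply: above_notin.
Qed.

Lemma holds_seqv w l A B : List.Forall (holds w) l -> seqv l A B ->
  in_level (rank w) A -> in_level (rank w) B -> holds w A <-> holds w B.
Proof.
move=> wl [[pAB _] [pBA _]] Aw Bw.
have mono C D : l ⊢ Imp C D -> in_level (rank w) D -> holds w C -> holds w D.
  move=> dCD Dw wC; apply: (holds_nd (l := C :: l)) Dw (nd_impE dCD).
  by constructor.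
by split; apply: mono.
Qed.

Lemma holds_inst_eq w s t A : (forall x, x \in fv A -> holds w (Eq (s x) (t x))) ->
  holds w (inst s A) <-> holds w (inst t A).
Proof.
move=> st; have lev x : x \in fv A -> level (s x) < rank w /\ level (t x) < rank w.
  by move=> /st/holds_in_level; rewrite /in_level /= andbT => /andP.
apply: (holds_seqv (l := [seq Eq (s x) (t x) | x <- fv A])).
- by apply/List.Forall_forall => B /List.in_map_iff[x [<- /In_mem/st]].
- by apply: seqv_inst => x xA; apply/nd_hyp/List.in_map_iff; exists x; split=> //; apply/In_mem.
- by apply: in_level_inst => x /lev[].
- by apply: in_level_inst => x /lev[].
Qed.

(** The domain of a world consists of chosen representatives of the classes of
    provably equal variables, since positive equality must be identity. *)
Definition rep w x : Ind := epsilon (inhabits 0) (fun y => holds w (Eq x y)).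

Lemma holds_eq_level w x y : holds w (Eq x y) -> level x < rank w /\ level y < rank w.
Proof. by move/holds_in_level; rewrite /in_level /= andbT => /andP. Qed.

Lemma holds_eq_refl w x : level x < rank w -> holds w (Eq x x).
Proof.
move=> xw; apply: (holds_nd (l := [::])) => //; last exact: nd_eq_refl.
by rewrite /in_level /= xw.
Qed.

Lemma holds_eq_sym w x y : holds w (Eq x y) -> holds w (Eq y x).
Proof.
move=> xy; have [xw yw] := holds_eq_level xy; apply: (holds_nd (l := [:: Eq x y])).
- by do ! constructor.
- by rewrite /in_level /= xw yw.
- by apply: nd_eq_sym; apply: nd_hyp; left.
Qed.

Lemma holds_eq_trans w x y z : holds w (Eq x y) -> holds w (Eq y z) -> holds w (Eq x z).
Proof.
move=> xy yz; have [[xw _] [_ zw]] := (holds_eq_level xy, holds_eq_level yz).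
apply: (holds_nd (l := [:: Eq x y; Eq y z])); first by do ! constructor.
  by rewrite /in_level /= xw zw.
by apply: (nd_eq_trans (y := y)); apply: nd_hyp; [left|right; left].
Qed.

Lemma holds_rep w x : level x < rank w -> holds w (Eq x (rep w x)).
Proof.
move=> xw; apply: (@epsilon_spec _ (inhabits 0) (fun y => holds w (Eq x y))).
by exists x; apply: holds_eq_refl.
Qed.

Lemma rep_level w x : level x < rank w -> level (rep w x) < rank w.
Proof. by move/holds_rep/holds_eq_level => []. Qed.

Lemma rep_eq w x y : holds w (Eq x y) -> rep w x = rep w y.
Proof.
move=> xy; rewrite /rep; congr epsilon; apply: functional_extensionality => z.
apply: propositional_extensionality; split; apply: holds_eq_trans => //.
exact: holds_eq_sym.
Qed.

Lemma rep_idem w x : level x < rank w -> rep w (rep w x) = rep w x.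
Proof. by move/holds_rep/rep_eq. Qed.

Definition dom w : Type := {x : Ind | level x < rank w /\ rep w x = x}.

Definition class w x (xw : level x < rank w) : dom w :=
  exist _ (rep w x) (conj (rep_level xw) (rep_idem xw)).

Lemma dom_inj w (a b : dom w) : sval a = sval b -> a = b.
Proof. by apply: eq_sig_hprop => x; apply: proof_irrelevance. Qed.

Lemma dom_class w (a : dom w) (aw : level (sval a) < rank w) : class aw = a.
Proof. by apply: dom_inj => /=; case: (svalP a). Qed.

Lemma dom_level w (a : dom w) : level (sval a) < rank w.
Proof. by case: (svalP a). Qed.

Lemma class_level w v (wv : below w v) (a : dom w) : level (sval a) < rank v.
Proof. by case: wv => rwv _; apply: leq_trans (dom_level a) rwv. Qed.

Definition dom_map w v (wv : below w v) (a : dom w) : dom v := class (class_level wv a).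

Lemma dom_map_id w (ww : below w w) (a : dom w) : dom_map ww a = a.
Proof. exact: dom_class. Qed.

Lemma dom_map_comp w v u (wv : below w v) (vu : below v u) (wu : below w u) (a : dom w) :
  dom_map vu (dom_map wv a) = dom_map wu a.
Proof.
apply: dom_inj => /=; apply/esym/rep_eq; case: vu => _; apply; apply: holds_rep.
exact: class_level.
Qed.

Lemma dom_nonempty w : inhabited (dom w).
Proof. by constructor; apply: (@class w (var_of_level 0 0)); rewrite level_var rank_gt0. Qed.

Lemma holds_inst_rep w s A : (forall x, x \in fv A -> level (s x) < rank w) ->
  holds w (inst s A) <-> holds w (inst (rep w \o s) A).
Proof. by move=> sw; apply: holds_inst_eq => x /sw; apply: holds_rep. Qed.

Lemma holds_rep_id w A : holds w A -> holds w (inst (rep w) A).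
Proof.
move=> wA; have /allP Aw := holds_in_level wA; apply/(holds_inst_rep (s := id) Aw).
by apply: holds_imp wA; [apply: in_level_inst|case: (seqv_inst_id [::] A) => _ []].
Qed.

End Membership.

(** * The canonical sheaf *)

Section Canonical.
Variable Omega : Pi -> Prop.
Implicit Types (A B : FO Omega) (w v : theory (sub_sig Omega)).

Definition Pi_code (P : Pi) : nat :=
  match P with S_ => 0 | O_ => 1 | E_ => 2 | R_ => 3 | p_ n => n.+4 end.

Lemma Pi_code_inj : injective Pi_code.
Proof. by case=> [n| | | |] [m| | | |] //= -[->]. Qed.

Lemma sub_sig_code_inj : injective (fun P : sub_sig Omega => Pi_code (sval P)).
Proof. by move=> P Q /Pi_code_inj PQ; apply: eq_sig_hprop PQ => x; apply: proof_irrelevance. Qed.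

Lemma canonical_extension k (Gamma Delta : FO Omega -> Prop) :
  (forall A, Gamma A -> in_level k A) -> (forall A, Delta A -> in_level k A) ->
  ~ QN4 Gamma Delta -> exists w : theory (sub_sig Omega),
  [/\ rank w = k.+1, forall A, Gamma A -> holds w A & forall A, Delta A -> ~ holds w A].
Proof.
by move=> Gk Dk; have [e e_surj] := form_enumeration sub_sig_code_inj; apply: theory_extension.
Qed.

Lemma theory_nonempty : inhabited (theory (sub_sig Omega)).
Proof.
have [//|//||w _] := @canonical_extension 0 (fun=> False) (fun=> False); last by constructor.
by move=> [A [m [AF _]]]; apply: List.Forall_inv AF.
Qed.

Definition literal_pos w : structure (sub_sig Omega) (dom w) :=
  fun P xs => holds w (Rel P (map_tuple sval xs)).

(** The value of the additional predicate is the set of pairs whose equation is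
    refuted by the theory. *)
Definition literal_neg w : structure (with_eps (sub_sig Omega)) (dom w) :=
  fun P => match P with
  | Some Q => fun xs => holds w (Neg (Rel Q (map_tuple sval xs)))
  | None => fun xs =>
      holds w (Neg (Eq (nth 0 (map_tuple sval xs) 0) (nth 0 (map_tuple sval xs) 1)))
  end.

Lemma literal_pos_hom w v (wv : below w v) :
  homomorphism (@literal_pos w) (@literal_pos v) (dom_map wv).
Proof.
move=> P a /(proj2 wv)/holds_rep_id; rewrite /literal_pos.
by congr (holds v (Rel P _)); apply: val_inj; rewrite /= -!map_comp.
Qed.

Lemma literal_neg_hom w v (wv : below w v) :
  homomorphism (@literal_neg w) (@literal_neg v) (dom_map wv).
Proof.
move=> [P|] a /(proj2 wv)/holds_rep_id /=.
  by congr (holds v (Neg (Rel P _))); apply: val_inj; rewrite /= -!map_comp.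
by case: a => [[|x [|y []]]].
Qed.

Definition canonical : sheaf Omega :=
  Sheaf theory_nonempty (@below_refl _) (@below_trans _) (@dom_nonempty _)
    literal_pos_hom literal_neg_hom (@dom_map_id _) (@dom_map_comp _).

(** Negative satisfaction is membership of the negated formula, so both kinds of
    satisfaction are treated by one statement. *)
Definition signed s A : FO Omega := if s is pos then A else Neg A.

Definition truth_for A s : Prop := forall (w : W canonical) (f : Ind -> U w),
  sat s A f <-> holds w (inst (sval \o f) (signed s A)).

Lemma push_level w v (wv : below w v) (f : Ind -> dom w) x : level (sval (f x)) < rank v.
Proof. exact: class_level. Qed.

Lemma truth_push A s (w v : W canonical) (wv : below w v) (f : Ind -> U w) :
  truth_for A s ->
  sat s A (push (wv : preceq w v) f) <-> holds v (inst (sval \o f) (signed s A)).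
Proof.
move=> tA; apply: iff_trans (tA _ _) _; apply: iff_sym; apply: holds_inst_rep => x _.
exact: push_level.
Qed.

(** The quantifier clauses of [sat] range over representatives, theories speak
    of all variables of their level; the two match because every such variable
    is provably equal to its representative. *)
Lemma truth_update A s (w v : W canonical) (wv : below w v) (f : Ind -> U w) x c
    (cv : level c < rank v) : truth_for A s ->
  sat s A (update (push (wv : preceq w v) f) x (class cv : U v)) <->
  holds v (inst (update (sval \o f) x c) (signed s A)).
Proof.
move=> tA; apply: iff_trans (tA _ _) _; apply: iff_sym.
have -> : sval \o update (push (wv : preceq w v) f) x (class cv : U v) =
    rep v \o update (sval \o f) x c.
  by apply: functional_extensionality => y; rewrite /update /=; case: eqP.
apply: holds_inst_rep => y _; rewrite /update; case: eqP => // _; exact: push_level.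
Qed.

Lemma truth_forall A s (w v : W canonical) (wv : below w v) (f : Ind -> U w) x :
  truth_for A s ->
  (forall a : U v, sat s A (update (push (wv : preceq w v) f) x a)) <->
  (forall c, level c < rank v -> holds v (inst (update (sval \o f) x c) (signed s A))).
Proof.
move=> tA; split=> [h c cv|h a]; first exact/(truth_update wv f x cv tA).
rewrite -(dom_class (dom_level a)); apply/truth_update => //; apply: h.
exact: dom_level.
Qed.

Lemma truth_exists A s (w : W canonical) (f : Ind -> U w) x : truth_for A s ->
  (exists a : U w, sat s A (update f x a)) <->
  (exists2 c, level c < rank w & holds w (inst (update (sval \o f) x c) (signed s A))).
Proof.
move=> tA; rewrite -{1}(push_refl (below_refl w : preceq w w) f); split=> [[a]|[c cw h]].
  rewrite -(dom_class (dom_level a)) => /(truth_update _ _ _ _ tA) h.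
  by exists (sval a); first exact: dom_level.
by exists (class cw : U w); apply/(truth_update _ _ _ _ tA).
Qed.

Lemma truth A s : truth_for A s.
Proof.
have flev B (v : W canonical) (g : Ind -> U v) : in_level (rank v) (inst (sval \o g) B).
  by apply: in_level_inst => x _; apply: dom_level.
have neg_iff B C (v : W canonical) (g : Ind -> U v) :
    axiom (Iff (inst (sval \o g) B) (inst (sval \o g) C)) ->
    holds v (inst (sval \o g) B) <-> holds v (inst (sval \o g) C).
  by move=> BC; apply: holds_iff.
elim: A s => [x y|P xs|A IA B IB|A IA B IB|A IA B IB|A IA|x A IA|x A IA] s w f.
- case: s => //=; split=> [->|xy]; first exact/holds_eq_refl/dom_level.
  have [_ ex] := svalP (f x); have [_ ey] := svalP (f y).
  by apply: dom_inj; rewrite -ex -ey; apply: rep_eq.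
- have mapE : map_tuple sval (map_tuple f xs) = map_tuple (sval \o f) xs.
    by apply: val_inj; rewrite /= -map_comp.
  by case: s; rewrite /= /literal_pos /literal_neg mapE.
- case: s => /=; rewrite IA IB; first by rewrite holds_and.
  rewrite -holds_or; try exact: (flev (Neg _)).
  exact: iff_sym (neg_iff (Neg (And A B)) (Or (Neg A) (Neg B)) _ _ (ax_negand _ _)).
- case: s => /=; rewrite IA IB; first by rewrite holds_or.
  rewrite -holds_and.
  exact: iff_sym (neg_iff (Neg (Or A B)) (And (Neg A) (Neg B)) _ _ (ax_negor _ _)).
- case: s.
    apply: iff_trans (sat_imp _ _ _) _; apply: iff_sym.
    have [e e_surj] := form_enumeration sub_sig_code_inj.
    apply: iff_trans (holds_arrow e_surj (flev (Imp A B) w f)) _.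
    have pushA v wv := @truth_push A pos w v wv f (IA pos).
    have pushB v wv := @truth_push B pos w v wv f (IB pos).
    split=> h v wv vA; first by apply/pushB/(h v wv)/pushA.
    by apply/(pushB v wv)/(h v wv)/(pushA v wv).
  rewrite /= IA IB -holds_and.
  exact: iff_sym (neg_iff (Neg (Imp A B)) (And A (Neg B)) _ _ (ax_negimp _ _)).
- case: s; first exact: (IA neg w f).
  apply: iff_trans (IA pos w f) _.
  exact: iff_sym (neg_iff (Neg (Neg A)) A _ _ (ax_negneg _)).
- have [e e_surj] := form_enumeration sub_sig_code_inj.
  case: s; apply: iff_sym.
    apply: iff_trans (holds_all e_surj (flev (All x A) w f)) _.
    by split=> h v wv; apply/(truth_forall wv f x (IA pos)); apply: (h v wv).
  apply: iff_trans (neg_iff (Neg (All x A)) (Ex x (Neg A)) _ _ (ax_negall _ _)) _.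
  apply: iff_trans (holds_ex (flev (Ex x (Neg A)) w f)) _.
  exact: iff_sym (truth_exists f x (IA neg)).
- have [e e_surj] := form_enumeration sub_sig_code_inj.
  case: s; apply: iff_sym.
    apply: iff_trans (holds_ex (flev (Ex x A) w f)) _.
    exact: iff_sym (truth_exists f x (IA pos)).
  apply: iff_trans (neg_iff (Neg (Ex x A)) (All x (Neg A)) _ _ (ax_negex _ _)) _.
  apply: iff_trans (holds_all e_surj (flev (All x (Neg A)) w f)) _.
  by split=> h v wv; apply/(truth_forall wv f x (IA neg)); apply: (h v wv).
Qed.

End Canonical.

(** * Adequacy *)

Theorem proposition2 (Omega : Pi -> Prop) (Gamma Delta : FO Omega -> Prop) :
  QN4 Gamma Delta <->
  ~ exists (S : sheaf Omega) (w : W S) (f : Ind -> U w),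
      (forall phi : FO Omega, Gamma phi -> sat pos phi f) /\
      (forall psi : FO Omega, Delta psi -> ~ sat pos psi f).
Proof.
split=> [[A [m [Am dA]]] [S [w [f [fG fD]]]]|noS].
  have [B mB sB] := sat_disj (derivable_sound fG dA).
  by apply: (fD B) sB; move/List.Forall_forall: Am; apply.
apply: NNPP => nG; apply: noS.
(* The even numbers are the variables of level 0. *)
pose s (x : Ind) : Ind := 2 * x.
have s_inj : injective s by move=> x y /eqP; rewrite eqn_pmul2l // => /eqP.
have slev x : level (s x) < 1.
  by rewrite /level /s logn_coprime // coprime2n /= mul2n odd_double.
have lev (X : FO Omega -> Prop) B : (exists A, X A /\ B = inst s A) -> in_level 1 B.
  by move=> [A [_ ->]]; apply: in_level_inst.
have [ent|w [rw wG wD]] := canonical_extension (lev Gamma) (lev Delta).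
  by apply: nG; apply: entails_inst s_inj ent.
have sw x : level (s x) < rank w by rewrite rw (leq_trans (slev x)).
pose f x : dom w := class (sw x).
have satE A : sat pos A (f : Ind -> @U _ (canonical Omega) w) <-> holds w (inst s A).
  apply: iff_trans (truth _ _ _) _; apply: iff_sym.
  by apply: holds_inst_rep => x _; apply: sw.
exists (canonical Omega), w, f; split=> A XA.
  by apply/satE/wG; exists A.
by move/satE; apply: wD; exists A.
Qed.
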